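(* Let $\{x_t\}$ be generated by the auto-conditioned variance-reduced stochastic projected gradient (AC-VR-SPG) method described in the context, with $b_t=T$ and $b_t'\ge1$. Suppose the output $x_{R(k)}$ at step $k\ge1$ is randomly chosen from $\{x_0,\dots,x_{k-1}\}$ according to (given the trajectory) $\mathbb P(x_{R(k)}=x_{t-1})=\big(\sum_{j=1}^k\tfrac1{\gamma_j}\big)^{-1}\tfrac1{\gamma_t}$, $t=1,\dots,k$. Then $$\mathbb E\Big[\sum_{t=1}^k\tfrac1{4\gamma_t}\|g_{X,R(k)}\|^2\Big]\le f(x_0)-f(x^* )+\frac{7\hat{\mathcal L}^2D_X^2}{2\bar{\mathcal L}_0}+\frac{3k\sigma^2}{8\bar{\mathcal L}_0N},$$ and consequently $$\mathbb E\big[\|g_{X,R(k)}\|^2\big]\le\frac{16\hat{\mathcal L}(f(x_0)-f(x^* ))}{k}+\frac{56\hat{\mathcal L}^3D_X^2}{\bar{\mathcal L}_0k}+\frac{6\hat{\mathcal L}\sigma^2}{\bar{\mathcal L}_0N}.$$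
   Context: $\|\cdot\|$, $\langle\cdot,\cdot\rangle$ are Euclidean; convention $\tfrac00=0$. $X\subseteq\mathbb R^n$ is a nonempty convex compact set with diameter $D_X=\max_{x,y\in X}\|x-y\|$; $f:X\to\mathbb R$ is continuously differentiable with $\|\nabla f(x)-\nabla f(y)\|\le L\|x-y\|$ for all $x,y\in X$ (hence $f(x)-f(y)-\langle\nabla f(y),x-y\rangle\le\tfrac L2\|x-y\|^2$), and, for some $l\in[0,L]$, $f(x)-f(y)-\langle\nabla f(y),x-y\rangle\ge-\tfrac l2\|x-y\|^2$ for all $x,y\in X$. $x^*$ is a minimizer of $f$ over $X$. Stochastic oracle: given $x\in X$ it returns $\mathcal F(x,\xi)$ and $\mathcal G(x,\xi)=\nabla\mathcal F(x,\xi)$, $\xi\in\Xi$ random; all samples are i.i.d. Assumptions, for all $x,y\in X$: $\mathbb E_\xi[\mathcal F(x,\xi)]=f(x)$, $\mathbb E_\xi[\mathcal G(x,\xi)]=\nabla f(x)$; $\mathbb E_\xi\|\mathcal G(x,\xi)-\nabla f(x)\|^2\le\sigma^2$ with $\sigma^2>0$; for each $\xi$ there is $\mathcal L(\xi)\ge0$ with $\|\mathcal G(x,\xi)-\mathcal G(y,\xi)\|\le\mathcal L(\xi)\|x-y\|$ and $\mathcal F(x,\xi)-\mathcal F(y,\xi)-\langle\mathcal G(y,\xi),x-y\rangle\le\tfrac{\mathcal L(\xi)}2\|x-y\|^2$, where $\mathcal L(\xi)\le\hat{\mathcal L}$ almost surely and $\mathbb E[\mathcal L(\xi)^2]\le\bar{\mathcal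 L}^2$. AC-VR-SPG method: given $x_0\in X$, epoch length $T$, batch sizes $N$, $b_t$, $b_t'$ (positive integers), and $0<\hat{\mathcal L}_{-1}=\bar{\mathcal L}_0\le\hat{\mathcal L}$, for $t=1,\dots,k$: (i) if $t$ is the first iteration of an epoch, i.e. $t=(s-1)T+1$ for some $s\ge1$ ($\mathrm{mod}(t,T)=1$): draw fresh i.i.d. samples $\xi_1,\dots,\xi_N$, set $\tilde G_t=\tfrac1N\sum_{i=1}^N\mathcal G(x_{t-1},\xi_i)$ and $\hat{\mathcal L}_{t-1}=\max\{\hat{\mathcal L}_{t-2},\bar{\mathcal L}_{t-1}\}$; (ii) otherwise: draw fresh i.i.d. samples $\xi^t_1,\dots,\xi^t_{b_t}$, set $\tilde G_t=\tfrac1{b_t}\sum_{i=1}^{b_t}[\mathcal G(x_{t-1},\xi^t_i)-\mathcal G(x_{t-2},\xi^t_i)]+\tilde G_{t-1}$, $\tilde{\mathcal L}_{t-1}=\sqrt{\frac{\sum_{i=1}^{b_t}\|\mathcal G(x_{t-1},\xi^t_i)-\mathcal G(x_{t-2},\xi^t_i)\|^2}{b_t\|x_{t-1}-x_{t-2}\|^2}}$ and $\hat{\mathcal L}_{t-1}=\max\{\hat{\mathcal L}_{t-2},\bar{\mathcal L}_{t-1},\tilde{\mathcal L}_{t-1}\}$; (iii) set $\gamma_t=4\hat{\mathcal L}_{t-1}$ and $x_t=\arg\min_{x\in X}\{\langle\tilde G_t,x\rangle+\tfrac{\gamma_t}2\|x_{t-1}-x\|^2\}$; (iv) draw fresh i.i.d.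 samples $\bar\xi^t_1,\dots,\bar\xi^t_{b_t'}$, set $\bar G_t(x)=\tfrac1{b_t'}\sum_i\mathcal G(x,\bar\xi^t_i)$, $\bar F_t(x)=\tfrac1{b_t'}\sum_i\mathcal F(x,\bar\xi^t_i)$ and $\bar{\mathcal L}_t=\frac{2(\bar F_t(x_t)-\bar F_t(x_{t-1})-\langle\bar G_t(x_{t-1}),x_t-x_{t-1}\rangle)}{\|x_t-x_{t-1}\|^2}$. Projected gradient: $P_X(x,g,\gamma):=\gamma(x-x^+)$, $x^+=\arg\min_{u\in X}\{\langle g,u\rangle+\tfrac\gamma2\|x-u\|^2\}$; $g_{X,t}:=P_X(x_t,\nabla f(x_t),\gamma_{t+1})$. *)

(* Defs.v *)
From HB Require Import structures.
From mathcomp Require Import all_boot all_order all_algebra.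
From mathcomp Require Import all_classical all_reals all_analysis.
Set Implicit Arguments.
Unset Strict Implicit.
Unset Printing Implicit Defensive.
Import Order.TTheory GRing.Theory Num.Theory.
Import numFieldNormedType.Exports.
Local Open Scope classical_set_scope.
Local Open Scope ring_scope.

(* The library norm on row vectors is the sup norm (same topology). *)
Definition edot (R : realType) (n : nat) (u v : 'rV[R]_n) : R :=
  \sum_(i < n) u 0 i * v 0 i.

Definition enorm (R : realType) (n : nat) (u : 'rV[R]_n) : R :=
  Num.sqrt (edot u u).

Definition ediam (R : realType) (n : nat) (X : set 'rV[R]_n) : R :=
  sup [set enorm (x - y) | x in X & y in X].

(* First-order expansion relative to X: the functions live on X, which may have
   empty interior; values outside X are irrelevant. *)
Definition is_gradient_on (R : realType) (n : nat) (X : set 'rV[R]_n)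
    (f : 'rV[R]_n -> R) (g : 'rV[R]_n -> 'rV[R]_n) : Prop :=
  forall x, X x ->
    (f y - f x - edot (g x) (y - x)) / enorm (y - x)
      @[y --> within X x^'] --> (0 : R).

Definition C1_on (R : realType) (n : nat) (X : set 'rV[R]_n)
    (f : 'rV[R]_n -> R) (gradf : 'rV[R]_n -> 'rV[R]_n) : Prop :=
  is_gradient_on X f gradf /\ {within X, continuous gradf}.

Record smooth_objective (R : realType) (n : nat) (X : set 'rV[R]_n)
    (f : 'rV[R]_n -> R) (gradf : 'rV[R]_n -> 'rV[R]_n) (L l : R) : Prop := {
  objective_C1 : C1_on X f gradf ;
  objective_lipschitz : forall x y, X x -> X y ->
    enorm (gradf x - gradf y) <= L * enorm (x - y) ;
  objective_curvature_range : 0 <= l <= L ;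
  objective_lower_curvature : forall x y, X x -> X y ->
    - (l / 2) * enorm (x - y) ^+ 2 <= f x - f y - edot (gradf y) (x - y) }.

(* mu is the law of a sample; Lxi is the sample-wise Lipschitz modulus, Lsup its
   almost sure bound and Lms its root-mean-square bound. *)
Record stochastic_oracle (R : realType) (n : nat) (d : measure_display)
    (Xi : measurableType d) (mu : probability Xi R) (X : set 'rV[R]_n)
    (f : 'rV[R]_n -> R) (gradf : 'rV[R]_n -> 'rV[R]_n)
    (F : 'rV[R]_n -> Xi -> R) (G : 'rV[R]_n -> Xi -> 'rV[R]_n)
    (sigma : R) (Lxi : Xi -> R) (Lsup Lms : R) : Prop := {
  oracle_gradient : forall z,
    is_gradient_on X (fun x => F x z) (fun x => G x z) ;
  oracle_F_integrable : forall x, X x ->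
    mu.-integrable [set: Xi] (fun z => (F x z)%:E) ;
  oracle_G_integrable : forall x, X x -> forall i,
    mu.-integrable [set: Xi] (fun z => (G x z 0 i)%:E) ;
  oracle_F_unbiased : forall x, X x -> ('E_mu[F x] = (f x)%:E)%E ;
  oracle_G_unbiased : forall x, X x -> forall i,
    ('E_mu[fun z => G x z 0%R i] = (gradf x 0%R i)%:E)%E ;
  oracle_variance : forall x, X x ->
    ('E_mu[fun z => (enorm (G x z - gradf x) ^+ 2)%R] <= (sigma ^+ 2)%:E)%E ;
  oracle_variance_pos : 0 < sigma ^+ 2 ;
  oracle_Lxi_measurable : measurable_fun [set: Xi] Lxi ;
  oracle_Lxi_ge0 : forall z, 0 <= Lxi z ;
  oracle_G_lipschitz : forall z x y, X x -> X y ->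
    enorm (G x z - G y z) <= Lxi z * enorm (x - y) ;
  oracle_F_upper_curvature : forall z x y, X x -> X y ->
    F x z - F y z - edot (G y z) (x - y) <= Lxi z / 2 * enorm (x - y) ^+ 2 ;
  oracle_Lxi_sup : {ae mu, forall z, Lxi z <= Lsup} ;
  oracle_Lxi_ms : ('E_mu[fun z => (Lxi z ^+ 2)%R] <= (Lms ^+ 2)%:E)%E }.

Definition is_argmin (R : realType) (n : nat) (X : set 'rV[R]_n)
    (h : 'rV[R]_n -> R) (u : 'rV[R]_n) : Prop :=
  X u /\ forall v, X v -> h u <= h v.

(* For X nonempty compact convex and gamma > 0 the minimizer exists and is
   unique, so the default value x of xget is never taken. *)
Definition prox_step (R : realType) (n : nat) (X : set 'rV[R]_n)
    (x g : 'rV[R]_n) (gamma : R) : 'rV[R]_n :=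
  xget x (is_argmin X (fun u => edot g u + gamma / 2 * enorm (x - u) ^+ 2)).

Definition proj_grad (R : realType) (n : nat) (X : set 'rV[R]_n)
    (x g : 'rV[R]_n) (gamma : R) : 'rV[R]_n :=
  gamma *: (x - prox_step X x g gamma).

(* For t >= 1: t = (s - 1) T + 1 for some s >= 1. *)
Definition epoch_start (T t : nat) : bool := (T %| t.-1)%N.

(* One run of the method, for given realizations of the samples: xi t i is the
   i-th sample of iteration t used for the gradient estimator, xibar t i the
   i-th one used for the curvature estimator.  Indices i start from 0.
   Lhat is shifted: Lhat t is \hat L_{t-1}, so Lhat 0 is \hat L_{-1}. The other
   sequences carry their own index. Division by 0 gives 0. *)
Record AC_VR_SPG_run (R : realType) (n : nat) (Xi : Type) (X : set 'rV[R]_n)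
    (F : 'rV[R]_n -> Xi -> R) (G : 'rV[R]_n -> Xi -> 'rV[R]_n)
    (k T N : nat) (b b' : nat -> nat) (x0 : 'rV[R]_n) (Lbar0 : R)
    (xi xibar : nat -> nat -> Xi)
    (x Gt : nat -> 'rV[R]_n) (Lhat Lbar gamma : nat -> R) : Prop := {
  run_x0 : x 0%N = x0 ;
  run_Lbar0 : Lbar 0%N = Lbar0 ;
  run_Lhat0 : Lhat 0%N = Lbar0 ;
  run_epoch_start : forall t, (1 <= t <= k)%N -> epoch_start T t ->
    Gt t = N%:R^-1 *: \sum_(i < N) G (x t.-1) (xi t i) /\
    Lhat t = Num.max (Lhat t.-1) (Lbar t.-1) ;
  run_epoch_inner : forall t, (1 <= t <= k)%N -> ~~ epoch_start T t ->
    Gt t = (b t)%:R^-1 *: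
        (\sum_(i < b t) (G (x t.-1) (xi t i) - G (x t.-2) (xi t i)))
      + Gt t.-1 /\
    Lhat t = Num.max (Num.max (Lhat t.-1) (Lbar t.-1))
      (Num.sqrt
        ((\sum_(i < b t) enorm (G (x t.-1) (xi t i) - G (x t.-2) (xi t i)) ^+ 2)
         / ((b t)%:R * enorm (x t.-1 - x t.-2) ^+ 2))) ;
  run_gamma : forall t, (1 <= t <= k)%N -> gamma t = 4 * Lhat t ;
  run_step : forall t, (1 <= t <= k)%N ->
    x t = prox_step X (x t.-1) (Gt t) (gamma t) ;
  run_Lbar : forall t, (1 <= t <= k)%N ->
    let Fbar y := (b' t)%:R^-1 * \sum_(i < b' t) F y (xibar t i) in
    let Gbar y := (b' t)%:R^-1 *: \sum_(i < b' t) G y (xibar t i) in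
    Lbar t =
      2 * (Fbar (x t) - Fbar (x t.-1) - edot (Gbar (x t.-1)) (x t - x t.-1))
      / enorm (x t - x t.-1) ^+ 2 }.

(* inl (t, i) stands for xi t i and inr (t, i) for xibar t i. *)
Definition sample (Omega Xi : Type) (xi xibar : Omega -> nat -> nat -> Xi)
    (j : (nat * nat) + (nat * nat)) : Omega -> Xi :=
  match j with
  | inl (t, i) => fun w => xi w t i
  | inr (t, i) => fun w => xibar w t i
  end.

Definition drawn (k T N : nat) (b b' : nat -> nat)
    (j : (nat * nat) + (nat * nat)) : bool :=
  match j with
  | inl (t, i) => (1 <= t <= k)%N && (i < if epoch_start T t then N else b t)%N
  | inr (t, i) => (1 <= t <= k)%N && (i < b' t)%N
  end.

Record iid_family (R : realType) (d d' : measure_display)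
    (Omega : measurableType d) (P : probability Omega R)
    (Xi : measurableType d') (mu : probability Xi R)
    (I : eqType) (D : pred I) (zeta : I -> Omega -> Xi) : Prop := {
  iid_measurable : forall j, D j -> measurable_fun [set: Omega] (zeta j) ;
  iid_law : forall j, D j -> forall A, measurable A ->
    P (zeta j @^-1` A) = mu A ;
  iid_independent : forall (s : seq I), uniq s -> all D s ->
    forall A : I -> set Xi, (forall j, measurable (A j)) ->
    (P (\bigcap_(j in [set` s]) (zeta j @^-1` A j))
     = \prod_(j <- s) P (zeta j @^-1` A j))%E }.

(* Sigma-algebra generated by x_{t-1} and gamma_t, t = 1, ..., k. *)
Definition trajectory_events (R : realType) (n k : nat) (Omega : Type)
    (x : Omega -> nat -> 'rV[R]_n) (gamma : Omega -> nat -> R) :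
    set (set Omega) :=
  <<s [set A | exists t : nat, (1 <= t <= k)%N /\
        exists U : set R, measurable U /\
          (A = (fun w => gamma w t) @^-1` U \/
           exists i : 'I_n, A = (fun w => x w t.-1 0 i) @^-1` U)] >>.

(* The conditional probability of {Rk = t - 1} given the trajectory is
   gamma_t^-1 / \sum_j gamma_j^-1, in its defining integral form. *)
Definition output_rule (R : realType) (n k : nat) (d : measure_display)
    (Omega : measurableType d) (P : probability Omega R)
    (x : Omega -> nat -> 'rV[R]_n) (gamma : Omega -> nat -> R)
    (Rk : Omega -> 'I_k) : Prop :=
  forall r : 'I_k,
    measurable [set w | Rk w = r] /\
    forall A, trajectory_events k x gamma A ->
      (P (A `&` [set w | Rk w = r])
       = \int[P]_(w in A)
           ((\sum_(1 <= j < k.+1) (gamma w j)^-1)^-1 * (gamma w r.+1)^-1)%:E)%E.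

(* Main.v *)
Require Import Defs.
From HB Require Import structures.
From mathcomp Require Import all_boot all_order all_algebra.
From mathcomp Require Import all_classical all_reals all_analysis.
From mathcomp Require Import measurable_realfun ring lra.
Import Order.TTheory GRing.Theory Num.Theory.
Import numFieldNormedType.Exports.
Local Open Scope classical_set_scope.
Local Open Scope ring_scope.

(** Why the bounds hold. Write M_t for the curvature estimate used at iteration
    t (so gamma_t = 4 M_t), s_t = x_t - x_{t-1} for the step and e_t for the
    error of the gradient estimate at x_{t-1}.

    Along every run, the variational inequality of the prox step and its
    nonexpansiveness give (descent_step)
      |g_{t-1}|^2 / (4 gamma_t) + M_t |s_t|^2
        <= - <grad f(x_{t-1}), s_t> + (3/8) |e_t|^2 / M_t .
    The pairing with the gradient is f(x_{t-1}) - f(x_t) plus the first-order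
    remainder of f. The curvature samples are fresh when the step is taken, so
    the expected remainder is that of the sampled functions, which is
    Lbar_t |s_t|^2 / 2 by the very definition of Lbar_t (expected_bregman).

    For the errors, each new gradient sample contributes an increment that is
    centered given the past, so mean squares add up (integral_sqr_increment).
    Weighting by the reciprocal of the previous estimate, which is known before
    the new samples are drawn, bounds the expectation of |e_t|^2 / M_t by
    sigma^2 / (N Lbar0) at the start of an epoch and otherwise by the previous
    such expectation plus 1/T times that of (M_t^2 / M_{t-1}) |s_{t-1}|^2
    (variance_epoch_start, variance_epoch_inner); an epoch having T iterations,
    each of these increments is charged at most once in total
    (epoch_error_sum).

    What remains at iteration t is at most
      (Lbar_t / 2 - M_t + (3/8) M_{t+1}^2 / M_t) |s_t|^2 ,
    and Lbar_t <= M_{t+1}. If M did not grow this would be negative; in general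
    it is at most a constant times M_{t+1} - M_t (step_balance), and these
    growths telescope to at most Lsup. The total is thus at most
    Lsup D_X^2 (3/4 Lsup / Lbar0 + 1/2), within the bound claimed because
    Lbar0 <= Lsup.

    The output index is then removed: its conditional law given the trajectory
    may replace its indicator against functions of the trajectory
    (integral_conditional_weight). The second bound follows from the first
    because gamma_t <= 4 Lsup almost surely.

    Underlying all expectations is one fact: a sample outside a given list is
    independent of the sigma-algebra generated by the samples in the list, so
    it can be integrated out with the past frozen (tonelli_past). This needs
    the iterates to be measurable functions of the samples (run_known), and
    hence joint measurability of functions that are Lipschitz in the point and
    measurable in the sample (measurable_caratheodory). *)

(** * Euclidean geometry and the prox step *)

Section Euclid.
Context {R : realType} {n : nat}.
Implicit Types (u v w : 'rV[R]_n) (a b : R).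

Lemma edotC u v : edot u v = edot v u.
Proof. by apply: eq_bigr => i _; rewrite mulrC. Qed.

Lemma edotDl u v w : edot (u + v) w = edot u w + edot v w.
Proof. by rewrite -big_split; apply: eq_bigr => i _; rewrite mxE mulrDl. Qed.

Lemma edotDr u v w : edot w (u + v) = edot w u + edot w v.
Proof. by rewrite edotC edotDl !(edotC w). Qed.

Lemma edotZl a u v : edot (a *: u) v = a * edot u v.
Proof. by rewrite mulr_sumr; apply: eq_bigr => i _; rewrite mxE mulrA. Qed.

Lemma edotZr a u v : edot v (a *: u) = a * edot v u.
Proof. by rewrite edotC edotZl edotC. Qed.

Lemma edotNl u v : edot (- u) v = - edot u v.
Proof. by rewrite -scaleN1r edotZl mulN1r. Qed.

Lemma edotNr u v : edot v (- u) = - edot v u.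
Proof. by rewrite edotC edotNl edotC. Qed.

Lemma edot0l u : edot 0 u = 0.
Proof. by rewrite -(scale0r u) edotZl mul0r. Qed.

Lemma edot0r u : edot u 0 = 0.
Proof. by rewrite edotC edot0l. Qed.

Definition edotE :=
  (edotDl, edotDr, edotNl, edotNr, edotZl, edotZr, edot0l, edot0r).

Lemma edot_suml (I : Type) (r : seq I) (V : I -> 'rV[R]_n) u :
  edot (\sum_(i <- r) V i) u = \sum_(i <- r) edot (V i) u.
Proof.
elim/big_rec2 : _ => [|i y1 y2 _ <-]; by rewrite ?edot0l ?edotDl.
Qed.

Lemma edot_ge0 u : 0 <= edot u u.
Proof. by apply: sumr_ge0 => i _; rewrite -expr2 sqr_ge0. Qed.

Lemma enorm_ge0 u : 0 <= enorm u.
Proof. exact: sqrtr_ge0. Qed.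

Lemma enorm_sqr u : enorm u ^+ 2 = edot u u.
Proof. by rewrite sqr_sqrtr// edot_ge0. Qed.

Lemma enorm_le u a : 0 <= a -> edot u u <= a ^+ 2 -> enorm u <= a.
Proof.
move=> a0 h; rewrite -(@ler_pXn2r _ 2) ?nnegrE ?enorm_ge0//.
by rewrite enorm_sqr.
Qed.

Lemma enormN u : enorm (- u) = enorm u.
Proof. by rewrite /enorm !edotE opprK. Qed.

Lemma enormB u v : enorm (u - v) = enorm (v - u).
Proof. by rewrite -enormN opprB. Qed.

Lemma enorm0 : enorm (0 : 'rV[R]_n) = 0.
Proof. by rewrite /enorm edot0l sqrtr0. Qed.

Lemma enormZ a u : enorm (a *: u) = `|a| * enorm u.
Proof.
by rewrite /enorm !edotE mulrA -expr2 sqrtrM ?sqr_ge0// sqrtr_sqr.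
Qed.

Lemma norm_coord_le_enorm u i : `|u 0 i| <= enorm u.
Proof.
rewrite -sqrtr_sqr ler_wsqrtr// /edot (bigD1 i)//= -expr2 lerDl.
by apply: sumr_ge0 => j _; rewrite -expr2 sqr_ge0.
Qed.

Lemma enorm_eq0 u : enorm u = 0 -> u = 0.
Proof.
move=> u0; apply/rowP => i; rewrite mxE; apply/eqP; rewrite -normr_le0 -u0.
exact: norm_coord_le_enorm.
Qed.

Lemma edot_le_enormM u v : edot u v <= enorm u * enorm v.
Proof.
have [v0|v0] := eqVneq (enorm v) 0.
  by rewrite (enorm_eq0 _ v0) edot0r mulr_ge0 ?enorm_ge0.
have vp : 0 < enorm v by rewrite lt_neqAle eq_sym v0 enorm_ge0.
have [u0|u0] := eqVneq (enorm u) 0.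
  by rewrite (enorm_eq0 _ u0) edot0l mulr_ge0 ?enorm_ge0.
have up : 0 < enorm u by rewrite lt_neqAle eq_sym u0 enorm_ge0.
have := edot_ge0 (enorm v *: u - enorm u *: v).
rewrite !edotE -!enorm_sqr (edotC v u) => h.
have {h} : 0 <= (2 * enorm u * enorm v) * (enorm u * enorm v - edot u v) by nra.
by rewrite pmulr_rge0 ?mulr_gt0// subr_ge0.
Qed.

Lemma normr_edot_le u v : `|edot u v| <= enorm u * enorm v.
Proof.
rewrite ler_norml edot_le_enormM andbT lerNl -edotNl -enormN.
exact: edot_le_enormM.
Qed.

Lemma enormD_le u v : enorm (u + v) <= enorm u + enorm v.
Proof.
apply: enorm_le; first by rewrite addr_ge0 ?enorm_ge0.
rewrite !edotE -!enorm_sqr (edotC v u); have := edot_le_enormM u v.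
by nra.
Qed.

Lemma enormB_le u v : enorm (u - v) <= enorm u + enorm v.
Proof. by rewrite -(enormN v) enormD_le. Qed.

Lemma enorm_le_sum u : enorm u <= \sum_(i < n) `|u 0 i|.
Proof.
apply: enorm_le; first exact: sumr_ge0.
rewrite /edot expr2 mulr_suml; apply: ler_sum => i _.
rewrite (le_trans (ler_norm _))// normrM ler_wpM2l//.
by rewrite (bigD1 i)//= lerDl sumr_ge0.
Qed.

End Euclid.

Section Prox.
Context {R : realType} {n : nat} (X : set 'rV[R]_n).
Implicit Types (x y u v g : 'rV[R]_n).

Lemma continuous_sumr (T : topologicalType) (I : Type) (r : seq I)
    (h : I -> T -> R) :
  (forall i, continuous (h i)) -> continuous (fun t => \sum_(i <- r) h i t).
Proof.
move=> hc; elim: r => [|i r IH] t.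
  by under eq_fun do rewrite big_nil; exact: cvg_cst.
under eq_fun do rewrite big_cons.
by apply: cvgD; [exact: hc|exact: IH].
Qed.

Lemma continuous_prox_objective x g (gamma : R) :
  continuous (fun u => edot g u + gamma / 2 * enorm (x - u) ^+ 2).
Proof.
under eq_fun do rewrite enorm_sqr.
have lin : continuous (edot g).
  apply: continuous_sumr => i v /=.
  by apply: continuousM; [exact: cst_continuous|exact: coord_continuous].
have quad : continuous (fun u => edot (x - u) (x - u)).
  apply: continuous_sumr => i v /=.
  have coordB : continuous (fun v : 'rV[R]_n => (x - v) 0 i).
    move=> w; under eq_fun do rewrite !mxE.
    by apply: continuousB; [exact: cst_continuous|exact: coord_continuous].
  by apply: continuousM; exact: coordB.
move=> u; apply: continuousD; first exact: lin.
by apply: continuousM; [exact: cst_continuous|exact: quad].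
Qed.

Hypotheses (X0 : X !=set0) (X_compact : compact X).
Hypothesis X_convex : convex_set (X : set (convex_lmodType 'rV[R]_n)).

Lemma prox_step_argmin x g gamma :
  is_argmin X (fun u => edot g u + gamma / 2 * enorm (x - u) ^+ 2)
    (prox_step X x g gamma).
Proof.
rewrite /prox_step; apply: xgetPex.
have [u Xu umin] := EVT_min_rV X0 X_compact
  (continuous_subspaceT (continuous_prox_objective x g gamma)).
exists u; split; first by rewrite inE in Xu.
by move=> v Xv; apply: umin; rewrite inE.
Qed.

Lemma prox_step_in x g gamma : X (prox_step X x g gamma).
Proof. by have [] := prox_step_argmin x g gamma. Qed.

Lemma convex_segment u v (t : R) : X u -> X v -> 0 <= t <= 1 ->
  X (u + t *: (v - u)).
Proof.
move=> Xu Xv /andP[t0 t1].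
have t01 : Itv.spec (@Itv.num_sem R) (Itv.Real `[0%Z, 1%Z]) t.
  by rewrite /= /Itv.num_sem /= num_real/= in_itv/= t0 t1.
have := X_convex v u (Itv.mk t01).
rewrite !inE => /(_ Xv Xu).
rewrite /conv/= /unstable.onem.
suff -> : u + t *: (v - u) = t *: v + (1 - t) *: u by [].
by rewrite scalerBr scalerBl scale1r addrCA.
Qed.

(** First-order optimality: moving from the minimizer towards any point of the
    convex set increases the objective, so the derivative at 0 along the
    segment is nonnegative. *)
Lemma prox_step_variational x g gamma v : X v ->
  0 <= edot (g + gamma *: (prox_step X x g gamma - x))
            (v - prox_step X x g gamma).
Proof.
set u := prox_step _ _ _ _ => Xv.
have [Xu umin] := prox_step_argmin x g gamma.
rewrite -/u in Xu umin.
set a := edot _ _; rewrite leNgt; apply/negP => a0.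
set c := gamma / 2 * edot (v - u) (v - u).
have along (t : R) : 0 < t -> t <= 1 -> 0 <= a + t * c.
  move=> t0 t1.
  have /umin : X (u + t *: (v - u)) by apply: convex_segment => //; rewrite ltW.
  rewrite !enorm_sqr.
  have -> : x - (u + t *: (v - u)) = - ((u - x) + t *: (v - u)).
    by rewrite -(opprB _ x) addrAC.
  have -> : x - u = - (u - x) by rewrite opprB.
  rewrite /a /c.
  move: (u - x) (v - u) => e h.
  rewrite !edotE (edotC h e) => le_h.
  rewrite -(pmulr_rge0 _ t0).
  by lra.
clearbody a c; have c0 : 0 < c by have := along 1 ltr01 (lexx _); lra.
(* The quadratic term t^2 c is at most half the linear one for such a t. *)
pose t := Num.min 1 (- a / (2 * c)).
have t0 : 0 < t.
  by rewrite lt_min ltr01 /= divr_gt0 ?oppr_gt0// mulr_gt0.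
have t1 : t <= 1 by rewrite ge_min lexx.
have t2 : t * c <= - a / 2.
  rewrite -ler_pdivlMr//; have -> : - a / 2 / c = - a / (2 * c).
    by rewrite invfM mulrA.
  by rewrite ge_min lexx orbT.
by have := along t t0 t1; lra.
Qed.

Lemma prox_step_unique x g (gamma : R) u : 0 < gamma -> X u ->
  (forall v, X v -> 0 <= edot (g + gamma *: (u - x)) (v - u)) ->
  u = prox_step X x g gamma.
Proof.
move=> gamma0 Xu uvar; set p := prox_step _ _ _ _.
have := uvar p (prox_step_in x g gamma).
have := prox_step_variational x g gamma u Xu; rewrite -/p.
have -> : g + gamma *: (p - x) = g + gamma *: (u - x) + gamma *: (p - u).
  by rewrite -addrA -scalerDr [u - x + _]addrC subrKA.
move: (g + _) => q; rewrite -(opprB p u) => h1 h2.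
suff : gamma * enorm (p - u) ^+ 2 <= 0.
  rewrite pmulr_rle0// => e0; apply/esym/subr0_eq/enorm_eq0/eqP.
  by rewrite -sqrf_eq0 eq_le e0 sqr_ge0.
by move: (p - u) h1 h2 => d; rewrite enorm_sqr edotNr edotDl edotZl; lra.
Qed.

(** All prox steps thereby reduce to one map of a single vector, a projection,
    whose nonexpansiveness gives both the sensitivity to the gradient estimate
    and the measurability of the iterates. *)
Lemma prox_stepE x g (gamma : R) : 0 < gamma ->
  prox_step X x g gamma = prox_step X (x - gamma^-1 *: g) 0 1.
Proof.
move=> gamma0; apply: prox_step_unique => //; first exact: prox_step_in.
move=> v Xv; have := prox_step_variational x g gamma v Xv.
set u := prox_step _ _ _ _.
have -> : g + gamma *: (u - x) = gamma *: (u - (x - gamma^-1 *: g)).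
  rewrite opprD opprK addrA [RHS]scalerDr scalerA divff ?gt_eqF// scale1r.
  exact: addrC.
by rewrite edotZl pmulr_rge0// add0r scale1r.
Qed.

(** Test the variational inequality of each projection at the other one and
    add. *)
Lemma projection_nonexpansive x y :
  enorm (prox_step X x 0 1 - prox_step X y 0 1) <= enorm (x - y).
Proof.
set p := prox_step X x 0 1; set q := prox_step X y 0 1.
have := prox_step_variational x 0 1 q (prox_step_in y 0 1); rewrite -/p.
have := prox_step_variational y 0 1 p (prox_step_in x 0 1); rewrite -/q.
rewrite !add0r !scale1r => hq hp.
have : edot (p - q) (p - q) <= edot (x - y) (p - q).
  have -> : x - y = (p - q) - (p - x) + (q - y).
    by apply/rowP => i; rewrite !mxE; ring.
  rewrite -(opprB p q) in hp.
  move: (p - q) (p - x) (q - y) hq hp => d e h.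
  by rewrite !edotDl edotNl edotNr; lra.
have := edot_le_enormM (x - y) (p - q); rewrite -enorm_sqr.
have := enorm_ge0 (p - q); have := enorm_ge0 (x - y).
have [->//|pq] := eqVneq (enorm (p - q)) 0.
move=> h1 h2 h3 h4.
have pq0 : 0 < enorm (p - q) by rewrite lt_neqAle eq_sym pq.
by rewrite -(ler_pM2r pq0) -expr2; exact: le_trans h4 h3.
Qed.

Lemma prox_step_lipschitz x g h (gamma : R) : 0 < gamma ->
  gamma * enorm (prox_step X x g gamma - prox_step X x h gamma)
    <= enorm (g - h).
Proof.
move=> gamma0; rewrite (prox_stepE x g)// (prox_stepE x h)//.
rewrite -ler_pdivlMl// mulrC.
apply: le_trans (projection_nonexpansive _ _) _.
rewrite (_ : _ - _ = gamma^-1 *: (h - g)); last first.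
  by rewrite scalerBr opprB addrC addrA addrNK.
by rewrite enormZ gtr0_norm ?invr_gt0// enormB mulrC.
Qed.

Lemma compact_enormB_bounded x : exists C : R,
  forall u, X u -> enorm (x - u) <= C.
Proof.
(* The prox objective with g = 0 and gamma = 2 is the squared distance to x. *)
have [c _ cmax] := EVT_max_rV X0 X_compact
  (continuous_subspaceT (continuous_prox_objective x 0 2)).
exists (enorm (x - c)) => u Xu; apply: enorm_le; first exact: enorm_ge0.
have /cmax : u \in X by rewrite inE.
by rewrite !edot0l !add0r divff// !mul1r enorm_sqr.
Qed.

Lemma enormB_le_ediam u v : X u -> X v -> enorm (u - v) <= ediam X.
Proof.
move=> Xu Xv; apply: ub_le_sup; last by exists u => //; exists v.
have [C hC] := compact_enormB_bounded u.
exists (C + C) => _ [x Xx [y Xy <-]].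
have -> : x - y = (u - y) - (u - x) by rewrite opprB [RHS]addrC subrKA.
by apply: le_trans (enormB_le _ _) _; rewrite lerD ?hC.
Qed.

End Prox.

(** * Measurability *)

Section MeasurableVectors.
Context {R : realType} {n : nat}.

(** Measurability of a vector-valued map is taken coordinatewise, which is what
    inner products and norms need. *)
Definition mvec {d} {T : measurableType d} (U : T -> 'rV[R]_n) :=
  forall i, measurable_fun [set: T] (fun t => U t 0 i).

Context {d} {T : measurableType d}.
Implicit Types (U V : T -> 'rV[R]_n) (a : T -> R).

Lemma measurable_fun_invr a : (forall t, 0 <= a t) ->
  measurable_fun [set: T] a -> measurable_fun [set: T] (fun t => (a t)^-1).
Proof.
move=> a0 ma.
(* The convention 0^-1 = 0 agrees with 0 `^ (-1) = 0. *)
rewrite (_ : (fun _ => _) = (fun t => a t `^ (-1))); last first.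
  by apply/funext => t; rewrite powR_inv1.
exact: (measurableT_comp (@measurable_powR R (-1)) ma).
Qed.

Lemma measurable_fun_sqrt a : (forall t, 0 <= a t) ->
  measurable_fun [set: T] a ->
  measurable_fun [set: T] (fun t => Num.sqrt (a t)).
Proof.
move=> a0 ma.
rewrite (_ : (fun _ => _) = (fun t => a t `^ 2^-1)); last first.
  by apply/funext => t; rewrite powR12_sqrt.
exact: (measurableT_comp (@measurable_powR R 2^-1) ma).
Qed.

Lemma mvec_cst (u : 'rV[R]_n) : mvec (fun _ : T => u).
Proof. by move=> i; exact: measurable_cst. Qed.

Lemma mvecD U V : mvec U -> mvec V -> mvec (fun t => U t + V t).
Proof.
by move=> mU mV i; under eq_fun do rewrite mxE; exact: measurable_funD.
Qed.

Lemma mvecZ a U : measurable_fun [set: T] a -> mvec U ->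
  mvec (fun t => a t *: U t).
Proof.
by move=> ma mU i; under eq_fun do rewrite mxE; exact: measurable_funM.
Qed.

Lemma mvecB U V : mvec U -> mvec V -> mvec (fun t => U t - V t).
Proof.
by move=> mU mV i; under eq_fun do rewrite !mxE; exact: measurable_funB.
Qed.

Lemma mvec_sum (I : eqType) (r : seq I) (W : I -> T -> 'rV[R]_n) :
  (forall i, i \in r -> mvec (W i)) -> mvec (fun t => \sum_(i <- r) W i t).
Proof.
elim: r => [|i r IH] mW.
  by under eq_fun do rewrite big_nil; exact: mvec_cst.
under eq_fun do rewrite big_cons; apply: mvecD.
  by apply: mW; rewrite mem_head.
by apply: IH => j jr; apply: mW; rewrite in_cons jr orbT.
Qed.

Lemma measurable_edot U V : mvec U -> mvec V ->
  measurable_fun [set: T] (fun t => edot (U t) (V t)).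
Proof.
by move=> mU mV; apply: measurable_sum => i; exact: measurable_funM.
Qed.

Lemma measurable_enorm U : mvec U ->
  measurable_fun [set: T] (fun t => enorm (U t)).
Proof.
move=> mU; apply: measurable_fun_sqrt => [t|]; first exact: edot_ge0.
exact: measurable_edot.
Qed.

Lemma mvec_comp {d'} {T' : measurableType d'} (p : T' -> T) U :
  measurable_fun [set: T'] p -> mvec U -> mvec (fun t => U (p t)).
Proof. by move=> mp mU i; exact: (measurableT_comp (mU i) mp). Qed.

End MeasurableVectors.

Section Caratheodory.
Context {R : realType} {n : nat}.

(** Every nonempty set of vectors contains a dense sequence: pick a point of the
    set near each rational vector, at each scale 1/(m+1) where there is one. *)
Lemma dense_sequence (A : set 'rV[R]_n) : A !=set0 ->
  exists q : nat -> 'rV[R]_n, (forall m, A (q m)) /\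
    forall x, A x -> forall e : R, 0 < e -> exists m, enorm (x - q m) < e.
Proof.
move=> [a0 Aa0].
pose near_pt (c : {ffun 'I_n -> rat} * nat) : 'rV[R]_n :=
  xget a0 (fun y => A y /\
    enorm (y - \row_i (ratr (c.1 i) : R)) <= c.2.+1%:R^-1).
pose q m := if unpickle m is Some c then near_pt c else a0.
exists q; split.
  move=> m; rewrite /q; case: (unpickle m) => // c.
  by rewrite /near_pt; case: xgetP => // y _ [].
move=> x Ax e e0.
pose m := Num.truncn (2 / e).
have me : 2 * m.+1%:R^-1 < e.
  by rewrite ltr_pdivrMr// mulrC -ltr_pdivrMr// truncnS_gt.
pose eps : R := (n.+1%:R * m.+1%:R)^-1.
have eps0 : 0 < eps by rewrite invr_gt0 mulr_gt0.
have /choice[c hc] : forall i, exists r : rat, `|x 0 i - ratr r| <= eps.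
  move=> i; have [|r] := @rat_in_itvoo R (x 0 i) (x 0 i + eps); first by lra.
  rewrite in_itv/= => /andP[r1 r2]; exists r.
  by rewrite ler_norml; apply/andP; split; lra.
pose cc := ([ffun i => c i], m) : {ffun 'I_n -> rat} * nat.
have xc : enorm (x - \row_i (ratr (cc.1 i) : R)) <= m.+1%:R^-1.
  apply: le_trans (enorm_le_sum _) _.
  have : \sum_(i < n) `|(x - \row_i (ratr (cc.1 i) : R)) 0 i|
      <= \sum_(i < n) eps.
    by apply: ler_sum => i _; rewrite !mxE ffunE hc.
  move=> /le_trans; apply; rewrite sumr_const card_ord -[eps *+ _]mulr_natl.
  rewrite /eps invfM mulrA ler_piMl ?invr_ge0//.
  by rewrite ler_pdivrMr// mul1r ler_nat.
exists (pickle cc); rewrite /q pickleK /near_pt.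
have [|_] := @xgetPex _ a0 (fun y => A y /\
  enorm (y - \row_i (ratr (cc.1 i) : R)) <= cc.2.+1%:R^-1); first by exists x.
set y := xget _ _ => yc; apply: le_lt_trans me.
have -> : x - y = (x - \row_i (ratr (cc.1 i) : R))
                  - (y - \row_i (ratr (cc.1 i) : R)).
  by rewrite opprB subrKA.
by apply: le_trans (enormB_le _ _) _; rewrite mulr_natl mulr2n lerD.
Qed.

(** A function that is Lipschitz in x on A and measurable in t is the infimum of
    the countably many cones [H (q m) t + K t * enorm (x - q m)], hence is
    jointly measurable. *)
Lemma measurable_caratheodory {d} {T : measurableType d} (A : set 'rV[R]_n)
    (H : 'rV[R]_n -> T -> R) (K : T -> R) (U : T -> 'rV[R]_n) :
  (forall t, A (U t)) -> mvec U -> measurable_fun [set: T] K ->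
  (forall x, A x -> measurable_fun [set: T] (H x)) ->
  (forall t x y, A x -> A y -> `|H x t - H y t| <= K t * enorm (x - y)) ->
  measurable_fun [set: T] (fun t => H (U t) t).
Proof.
move=> AU mU mK mH lipH.
have [t0|noT] := pselect (exists t : T, True); last first.
  rewrite (_ : [set: T] = set0); first exact: measurable_fun_set0.
  by apply/seteqP; split=> // t _; case: noT; exists t.
have [|q [Aq qdense]] := @dense_sequence A.
  by have [t _] := t0; exists (U t).
apply: (measurability _ (RGenInftyO.measurableE R)) => _ [_ [a ->] <-].
rewrite (_ : _ `&` _ =
  \bigcup_m (setT `&` (fun t => H (q m) t + K t * enorm (U t - q m))
               @^-1` `]-oo, a[)).
  apply: bigcup_measurable => m _.
  have mm : measurable_fun [set: T]
      (fun t => H (q m) t + K t * enorm (U t - q m)).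
    apply: measurable_funD; first exact: mH.
    apply: measurable_funM => //; apply: measurable_enorm.
    by apply: mvecB => //; exact: mvec_cst.
  by apply: mm => //; exact: measurable_itv.
rewrite -setI_bigcupr; congr (_ `&` _); apply/seteqP; split => t /=.
  rewrite in_itv/= => Ha.
  pose e := (a - H (U t) t) / (2 * (1 + `|K t|)).
  have K0 : 0 < 2 * (1 + `|K t|) by rewrite mulr_gt0// ltr_pwDl.
  have [|m hm] := qdense (U t) (AU t) e; first by rewrite divr_gt0// subr_gt0.
  exists m => //; rewrite /= in_itv/=.
  have := lipH t (U t) (q m) (AU t) (Aq m); rewrite ler_norml => /andP[h _].
  have := ler_norm (K t); have := normr_ge0 (K t).
  have := enorm_ge0 (U t - q m).
  move: hm; rewrite /e ltr_pdivlMr// => hm.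
  by move: (enorm _) hm h => r; nra.
move=> [m _]; rewrite /= !in_itv/=; apply: le_lt_trans.
have := lipH t (U t) (q m) (AU t) (Aq m); rewrite ler_norml => /andP[_ h].
by rewrite -lerBlDl.
Qed.

Context (X : set 'rV[R]_n) (X0 : X !=set0) (X_compact : compact X).
Hypothesis X_convex : convex_set (X : set (convex_lmodType 'rV[R]_n)).

Lemma mvec_prox_step {d} {T : measurableType d} (x g : T -> 'rV[R]_n)
    (gamma : T -> R) :
  mvec x -> mvec g -> measurable_fun [set: T] gamma ->
  (forall t, 0 < gamma t) ->
  mvec (fun t => prox_step X (x t) (g t) (gamma t)).
Proof.
move=> mx mg mgamma gamma0 i.
under eq_fun do rewrite (prox_stepE X X0 X_compact X_convex _ _ _ (gamma0 _)).
apply: (@measurable_caratheodory _ T setT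
  (fun y _ => prox_step X y 0 1 0 i) (cst 1)
  (fun t => x t - (gamma t)^-1 *: g t)).
- by [].
- apply: mvecB => //; apply: mvecZ => //.
  by apply: measurable_fun_invr => // t; exact: ltW.
- exact: measurable_cst.
- by move=> y _; exact: measurable_cst.
- move=> t y z _ _; rewrite mul1r.
  apply: le_trans (projection_nonexpansive X X0 X_compact X_convex y z).
  have := norm_coord_le_enorm (prox_step X y 0 1 - prox_step X z 0 1) i.
  by rewrite !mxE.
Qed.

Lemma mvec_proj_grad {d} {T : measurableType d} (x g : T -> 'rV[R]_n)
    (gamma : T -> R) :
  mvec x -> mvec g -> measurable_fun [set: T] gamma ->
  (forall t, 0 < gamma t) ->
  mvec (fun t => proj_grad X (x t) (g t) (gamma t)).
Proof.
move=> mx mg mgamma gamma0; apply: mvecZ => //; apply: mvecB => //.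
exact: mvec_prox_step.
Qed.

End Caratheodory.

(** * Independence of the past and a fresh sample *)

Section Freezing.
Context {R : realType} {d dT dXi : measure_display}.
Context {Omega : measurableType d} (P : probability Omega R).
Context {T : measurableType dT} {Xi : measurableType dXi}.
Context (mu : probability Xi R) (p : Omega -> T) (zeta : Omega -> Xi).

(** A fresh sample may be integrated out with the past frozen: the joint law of
    the past and the sample is a product measure. *)
Lemma tonelli_independent (phi : T * Xi -> \bar R) :
  measurable_fun [set: Omega] p -> measurable_fun [set: Omega] zeta ->
  (forall B A, measurable B -> measurable A ->
    P (p @^-1` B `&` zeta @^-1` A) = (P (p @^-1` B) * mu A)%E) ->
  measurable_fun [set: T * Xi] phi -> (forall u, 0 <= phi u)%E ->
  (\int[P]_w phi (p w, zeta w) = \int[P]_w \int[mu]_z phi (p w, z))%E.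
Proof.
move=> mp mz indep mphi phi0.
pose pM := isMeasurableFun.Build _ _ _ _ p mp.
pose pF : {mfun _ >-> _} := HB.pack p pM.
pose j w := (p w, zeta w).
have mj : measurable_fun [set: Omega] j by exact: measurable_fun_pair.
pose jM := isMeasurableFun.Build _ _ _ _ j mj.
pose jF : {mfun _ >-> _} := HB.pack j jM.
pose Pp : probability T R := [the probability T R of distribution P pF].
pose Pj : probability (T * Xi)%type R := [the probability _ R of distribution P jF].
have prodE (A : set (T * Xi)) : measurable A -> (Pp \x mu)%E A = Pj A.
  apply: product_measure_unique => B A' mB mA.
  by rewrite /Pj /pushforward /= -indep.
rewrite -[LHS](@ge0_integral_pushforward _ _ _ _ _ j mj P setT phi)//.
rewrite -[RHS](@ge0_integral_pushforward _ _ _ _ _ p mp P setT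
  (fun u => \int[mu]_z phi (u, z)))%E//; first last.
- by move=> y _; exact: integral_ge0.
- exact: measurable_fun_fubini_tonelli_F.
rewrite -[RHS](fubini_tonelli1 (m1 := Pp) (m2 := mu) phi)//.
by apply: eq_measure_integral => A mA _; exact/esym/prodE.
Qed.

End Freezing.

Section Past.
Context {R : realType} {d dXi : measure_display}.
Context {Omega : measurableType d} (P : probability Omega R).
Context {Xi : measurableType dXi} (mu : probability Xi R).
Context {I : eqType} (D : pred I) (zeta : I -> Omega -> Xi).

Definition rectangles (s : seq I) : set (set Omega) :=
  [set B | exists2 A : I -> set Xi, (forall j, measurable (A j)) &
     B = \bigcap_(j in [set` s]) (zeta j @^-1` A j)].

(** Omega as seen by an observer who knows only the samples of index in s. *)
Definition past (s : seq I) := g_sigma_algebraType (rectangles s).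

Lemma measurable_sample_past s j : j \in s ->
  measurable_fun [set: past s] (zeta j).
Proof.
move=> js _ A mA; rewrite setTI; apply: sub_sigma_algebra.
exists (fun i => if i == j then A else setT).
  by move=> i; case: ifP.
apply/seteqP; split=> [w Aw i _ /=|w /(_ j js)/=]; last by rewrite eqxx.
by case: eqP => // ->.
Qed.

Hypothesis iid : iid_family P mu D zeta.
Context (s : seq I).
Hypotheses (s_uniq : uniq s) (sD : all D s).

Lemma rectangles_measurable : rectangles s `<=` measurable.
Proof.
move=> _ [A mA ->]; apply: fin_bigcap_measurable; first exact: finite_seq.
move=> j js; rewrite -[X in measurable X]setTI.
by apply: (iid_measurable iid) => //; exact: (allP sD).
Qed.

Lemma measurable_past : measurable_fun [set: Omega] (id : Omega -> past s).
Proof.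
move=> _ B mB; rewrite setTI preimage_id.
by apply: (smallest_sub _ rectangles_measurable) mB; exact: sigma_algebra_measurable.
Qed.

(** As functions of B, both sides are finite measures; they agree on rectangles
    by independence, and rectangles are stable under intersection. *)
Lemma past_independent j : j \notin s -> D j -> forall (B : set (past s)) A,
  measurable B -> measurable A ->
  P (B `&` zeta j @^-1` A) = (P B * mu A)%E.
Proof.
move=> js Dj B A mB mA.
have mzA : measurable (zeta j @^-1` A).
  by rewrite -[X in measurable X]setTI; exact: (iid_measurable iid).
have muA : mu A \is a fin_num by rewrite fin_num_measure.
pose r : {nonneg R} := NngNum (fine_ge0 (measure_ge0 mu A)).
have rE : r%:num%:E = mu A by rewrite /= fineK.
suff -> : P (B `&` zeta j @^-1` A) = mscale r P B.
  by rewrite /mscale rE muleC.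
rewrite -[LHS]/(mrestr P mzA B).
apply: (@g_sigma_algebra_measure_unique _ R Omega (rectangles s) _
  (fun=> setT)) mB.
- exact: rectangles_measurable.
- move=> _; exists (fun=> setT); first by move=> i; exact: measurableT.
  by apply/seteqP; split.
- by apply/seteqP; split => // w _; exists 0%N.
- move=> _ _ [B1 mB1 ->] [B2 mB2 ->].
  exists (fun i => B1 i `&` B2 i); first by move=> i; exact: measurableI.
  by rewrite -bigcapI.
- move=> _ [C mC ->]; rewrite /= /mrestr /mscale rE.
  pose C' i := if i == j then A else C i.
  have mC' i : measurable (C' i) by rewrite /C'; case: ifP.
  have C's i : i \in s -> C' i = C i.
    by rewrite /C'; case: eqP => // -> jins; rewrite jins in js.
  transitivity (P (\bigcap_(i in [set` j :: s]) (zeta i @^-1` C' i))).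
    congr (P _); apply/seteqP; split => w.
      move=> [Cw Aw] i; rewrite /= in_cons /C'; case: eqP => [->//|_ /=].
      exact: Cw.
    move=> C'w; split.
      move=> i si; rewrite /= -C's//; apply: C'w.
      by rewrite /= in_cons si orbT.
    have := C'w j; rewrite /= mem_head /C' eqxx; exact.
  rewrite (iid_independent iid) ?big_cons//=; last 2 first.
  - by rewrite js.
  - by rewrite Dj.
  rewrite (iid_law iid)// {1}/C' eqxx; congr (_ * _)%E.
  rewrite -(iid_independent iid)//; congr (P _).
  by apply: eq_bigcapr => i si; rewrite C's.
- by move=> _; rewrite /= /mrestr setTI (le_lt_trans (probability_le1 _ _)) ?ltry.
Qed.

Lemma tonelli_past j (phi : past s * Xi -> \bar R) : j \notin s -> D j ->
  measurable_fun [set: past s * Xi] phi -> (forall u, 0 <= phi u)%E ->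
  (\int[P]_w phi (w, zeta j w) = \int[P]_w \int[mu]_z phi (w, z))%E.
Proof.
move=> js Dj mphi phi0.
apply: (@tonelli_independent _ _ _ _ _ P _ _ mu (id : Omega -> past s)) => //.
- exact: measurable_past.
- exact: (iid_measurable iid).
- by move=> B A mB mA; rewrite preimage_id past_independent.
Qed.

End Past.

(** * Orthogonality of mean-zero increments *)

Section Orthogonality.
Context {R : realType} {n : nat} {dXi : measure_display}.
Context {Xi : measurableType dXi} (mu : probability Xi R).

Definition centered (Y : Xi -> 'rV[R]_n) : Prop :=
  [/\ forall i, mu.-integrable [set: Xi] (fun z => (Y z 0 i)%:E),
      forall i, (\int[mu]_z (Y z 0 i)%:E = 0)%E
    & mu.-integrable [set: Xi] (fun z => (enorm (Y z) ^+ 2)%:E)].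

Lemma integral_sqr_centered (Y : Xi -> 'rV[R]_n) (s : 'rV[R]_n) (c : R) :
  centered Y ->
  (\int[mu]_z (enorm (s + c *: Y z) ^+ 2)%:E
   = (enorm s ^+ 2)%:E + (c ^+ 2)%:E * \int[mu]_z (enorm (Y z) ^+ 2)%:E)%E.
Proof.
move=> [iY Y0 iY2].
have iconst : mu.-integrable [set: Xi] (fun=> (enorm s ^+ 2)%:E).
  by apply: finite_measure_integrable_cst.
have iZ (a : R) i : mu.-integrable [set: Xi] (fun z => (a%:E * (Y z 0 i)%:E)%E).
  exact: integrableZl.
transitivity (\int[mu]_z ((enorm s ^+ 2)%:E
  + \sum_(i < n) ((2 * c * s 0 i)%:E * (Y z 0 i)%:E)
  + (c ^+ 2)%:E * (enorm (Y z) ^+ 2)%:E))%E.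
  apply: eq_integral => z _.
  under eq_bigr do rewrite -EFinM.
  rewrite sumEFin -EFinM -!EFinD !enorm_sqr !edotE (edotC (Y z) s).
  congr EFin.
  have -> : \sum_(i < n) 2 * c * s 0 i * Y z 0 i = 2 * c * edot s (Y z).
    by rewrite mulr_sumr; apply: eq_bigr => i _; rewrite mulrA.
  by ring.
rewrite integralD//=; last 2 first.
- by apply: integrableD => //; apply: integrable_sum.
- exact: integrableZl.
rewrite integralD//=; last by apply: integrable_sum.
rewrite integral_cst// [X in (_ * X)%E](_ : _ = 1%E); last exact: probability_setT.
rewrite mule1 integral_sum//.
rewrite big1 ?adde0; last by move=> i _; rewrite integralZl// Y0 mule0.
by rewrite integralZl.
Qed.

Context {d : measure_display} {Omega : measurableType d} (P : probability Omega R).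
Context {I : eqType} (D : pred I) (zeta : I -> Omega -> Xi).
Hypothesis iid : iid_family P mu D zeta.
Context (s : seq I).
Hypotheses (s_uniq : uniq s) (sD : all D s).
Context (j : I) (js : j \notin s) (Dj : D j).

(** With the past frozen, the cross term between S and the increment is linear
    in the increment and integrates to zero. *)
Lemma integral_sqr_increment (a : Omega -> R) (S : Omega -> 'rV[R]_n)
    (H : Omega -> Xi -> 'rV[R]_n) (c : R) :
  (forall w, 0 <= a w) ->
  measurable_fun [set: past zeta s] (a : past zeta s -> R) ->
  mvec (S : past zeta s -> 'rV[R]_n) ->
  mvec (fun u : past zeta s * Xi => H u.1 u.2) ->
  (forall w, centered (H w)) ->
  (\int[P]_w (a w * enorm (S w + c *: H w (zeta j w)) ^+ 2)%:E
   = \int[P]_w (a w * enorm (S w) ^+ 2)%:E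
     + (c ^+ 2)%:E * \int[P]_w (a w * enorm (H w (zeta j w)) ^+ 2)%:E)%E.
Proof.
move=> a0 ma mS mH Hc.
have m1 : measurable_fun [set: past zeta s * Xi] (fun u => a u.1).
  exact: (measurableT_comp ma measurable_fst).
have mS1 : mvec (fun u : past zeta s * Xi => S u.1).
  exact: (mvec_comp _ _ measurable_fst mS).
have mp := measurable_past P mu D zeta iid s sD.
have sq_ge0 (v : 'rV[R]_n) w : (0 <= (a w * enorm v ^+ 2)%:E)%E.
  by rewrite lee_fin mulr_ge0// sqr_ge0.
have mphi : measurable_fun [set: past zeta s * Xi]
    (fun u => (a u.1 * enorm (S u.1 + c *: H u.1 u.2) ^+ 2)%:E).
  apply/measurable_EFinP/measurable_funM => //; apply: measurable_funX.
  apply: measurable_enorm; apply: mvecD => //.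
  by apply: (mvecZ (cst c)).
have mpsi : measurable_fun [set: past zeta s * Xi]
    (fun u => (a u.1 * enorm (H u.1 u.2) ^+ 2)%:E).
  apply/measurable_EFinP/measurable_funM => //; apply: measurable_funX.
  exact: measurable_enorm.
have c20 : (0 <= (c ^+ 2)%:E)%E by rewrite lee_fin sqr_ge0.
rewrite (tonelli_past P mu D zeta iid s s_uniq sD j _ js Dj mphi)//=.
rewrite (tonelli_past P mu D zeta iid s s_uniq sD j _ js Dj mpsi)//=.
have mF : measurable_fun [set: Omega]
    (fun w => \int[mu]_z (a w * enorm (H w z) ^+ 2)%:E)%E.
  have := measurable_fun_fubini_tonelli_F (m2 := mu) _ mpsi.
  move=> h; apply: (measurableT_comp (h _) mp).
  by move=> u; exact: sq_ge0.
have F0 w : (0 <= \int[mu]_z (a w * enorm (H w z) ^+ 2)%:E)%E.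
  by apply: integral_ge0 => z _.
rewrite -ge0_integralZl// -ge0_integralD//=.
- apply: eq_integral => w _.
  have mH2 : measurable_fun [set: Xi] (fun z => (enorm (H w z) ^+ 2)%:E).
    by have [_ _ /integrableP[]] := Hc w.
  have mH3 : measurable_fun [set: Xi]
      (fun z => (enorm (S w + c *: H w z) ^+ 2)%:E).
    apply/measurable_EFinP/measurable_funX/measurable_enorm.
    apply: mvecD; first exact: mvec_cst.
    apply: (mvecZ (cst c)) => // i; have [h _ _] := Hc w.
    by have /integrableP[/measurable_EFinP] := h i.
  under eq_integral do rewrite EFinM.
  under [in RHS]eq_integral do rewrite EFinM.
  rewrite ge0_integralZl//; last 2 first.
  - by move=> z _; rewrite lee_fin sqr_ge0.
  - by rewrite lee_fin.
  rewrite ge0_integralZl//; last 2 first.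
  - by move=> z _; rewrite lee_fin sqr_ge0.
  - by rewrite lee_fin.
  rewrite integral_sqr_centered//.
  rewrite ge0_muleDr ?lee_fin ?sqr_ge0//; last first.
    by rewrite mule_ge0// integral_ge0// => z _; rewrite lee_fin sqr_ge0.
  by rewrite -EFinM [in LHS]muleCA.
- apply/measurable_EFinP/measurable_funM.
    exact: (measurableT_comp ma mp).
  apply/measurable_funX/measurable_enorm; exact: (mvec_comp _ _ mp mS).
- by move=> w _; rewrite mule_ge0.
- exact: measurable_funeM.
Qed.

End Orthogonality.

(** * The objective and its stochastic oracle *)

Section Bregman.
Context {R : realType} {n : nat} (X : set 'rV[R]_n).
Context (f : 'rV[R]_n -> R) (g : 'rV[R]_n -> 'rV[R]_n).

Definition bregman x y := f x - f y - edot (g y) (x - y).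

(** Exchanging x and y turns an upper curvature bound into a lower one: the two
    remainders add up to the gradient increment paired with x - y. *)
Lemma normr_bregmanD (K : R) x y :
  enorm (g x - g y) <= K * enorm (x - y) ->
  `|bregman x y + bregman y x| <= K * enorm (x - y) ^+ 2.
Proof.
move=> lip; rewrite (_ : _ + _ = edot (g x - g y) (x - y)); last first.
  by rewrite /bregman -(opprB x y) edotNr edotDl edotNl; ring.
apply: le_trans (normr_edot_le _ _) _.
by rewrite expr2 mulrA ler_wpM2r ?enorm_ge0.
Qed.

(** Lipschitz continuity is what makes these functions jointly measurable in the
    point and the sample. The gradient is bounded through its value at one
    point x0, which for a sampled function depends measurably on the sample. *)
Lemma lipschitz_of_bregman (C K : R) x0 x y :
  0 <= C -> 0 <= K -> (forall u v, X u -> X v -> enorm (u - v) <= ediam X) ->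
  (forall u v, X u -> X v -> enorm (g u - g v) <= K * enorm (u - v)) ->
  (forall u v, X u -> X v -> `|bregman u v| <= C * enorm (u - v) ^+ 2) ->
  X x0 -> X x -> X y ->
  `|f x - f y| <= (enorm (g x0) + (K + C) * ediam X) * enorm (x - y).
Proof.
move=> C0 K0 diam lip breg X0 Xx Xy.
have -> : f x - f y = edot (g y) (x - y) + bregman x y.
  by rewrite /bregman; ring.
apply: le_trans (ler_normD _ _) _.
apply: le_trans (lerD (normr_edot_le _ _) (breg x y Xx Xy)) _.
have gy : enorm (g y) <= enorm (g x0) + K * ediam X.
  rewrite (_ : g y = g x0 + (g y - g x0)); last by rewrite addrC subrK.
  apply: le_trans (enormD_le _ _) _; rewrite lerD2l.
  by apply: le_trans (lip _ _ Xy X0) _; rewrite ler_wpM2l// diam.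
have := diam x y Xx Xy; have := enorm_ge0 (x - y).
move: (enorm (x - y)) (enorm (g y)) (enorm (g x0)) gy => r a b ab r0 rD.
rewrite -subr_ge0.
rewrite (_ : _ - _ = r * (b + K * ediam X - a) + C * (r * (ediam X - r))).
  by rewrite addr_ge0// !mulr_ge0// subr_ge0.
by ring.
Qed.

End Bregman.

Section Oracle.
Context {R : realType} {n : nat} {X : set 'rV[R]_n} {f : 'rV[R]_n -> R}
  {gradf : 'rV[R]_n -> 'rV[R]_n} {L l : R}.
Hypothesis X_compact : compact X.
Hypothesis f_smooth : smooth_objective X f gradf L l.

Lemma L_ge0 : 0 <= L.
Proof. by have /andP[] := objective_curvature_range f_smooth; exact: le_trans. Qed.

Lemma normr_bregman_objective x y : X x -> X y ->
  `|bregman f gradf x y| <= (l / 2 + L) * enorm (x - y) ^+ 2.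
Proof.
move=> Xx Xy; have /andP[l0 lL] := objective_curvature_range f_smooth.
have lip := objective_lipschitz f_smooth Xx Xy.
have := normr_bregmanD f gradf L x y lip.
have := objective_lower_curvature f_smooth Xx Xy.
have := objective_lower_curvature f_smooth Xy Xx.
rewrite -!/(bregman f gradf _ _) (enormB y x).
have := sqr_ge0 (enorm (x - y)).
move: (enorm (x - y) ^+ 2) => r; rewrite !ler_norml => r0 h1 h2 /andP[h3 h4].
by apply/andP; split; nra.
Qed.

Definition Lip_f (x0 : 'rV[R]_n) := enorm (gradf x0) + (L + (l / 2 + L)) * ediam X.

Lemma objective_fun_lipschitz x0 x y : X x0 -> X x -> X y ->
  `|f x - f y| <= Lip_f x0 * enorm (x - y).
Proof.
have /andP[l0 lL] := objective_curvature_range f_smooth.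
apply: (@lipschitz_of_bregman _ _ X f gradf (l / 2 + L) L x0).
- by have := L_ge0; lra.
- exact: L_ge0.
- by move=> u v Xu; apply: enormB_le_ediam => //; exists u.
- by move=> u v; exact: (objective_lipschitz f_smooth).
- exact: normr_bregman_objective.
Qed.

Context {dXi : measure_display} {Xi : measurableType dXi} {mu : probability Xi R}.
Context {F : 'rV[R]_n -> Xi -> R} {G : 'rV[R]_n -> Xi -> 'rV[R]_n}.
Context {sigma : R} {Lxi : Xi -> R} {Lsup Lms : R}.
Hypothesis oracle : stochastic_oracle mu X f gradf F G sigma Lxi Lsup Lms.

Lemma normr_bregman_sample z x y : X x -> X y ->
  `|bregman (F ^~ z) (G ^~ z) x y| <= 3 / 2 * Lxi z * enorm (x - y) ^+ 2.
Proof.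
move=> Xx Xy.
have lip := oracle_G_lipschitz oracle z Xx Xy.
have := normr_bregmanD (F ^~ z) (G ^~ z) (Lxi z) x y lip.
have := oracle_F_upper_curvature oracle z Xx Xy.
have := oracle_F_upper_curvature oracle z Xy Xx.
rewrite -!/(bregman (F ^~ z) (G ^~ z) _ _) (enormB y x).
have := sqr_ge0 (enorm (x - y)); have := oracle_Lxi_ge0 oracle z.
move: (enorm (x - y) ^+ 2) => r; rewrite !ler_norml => L0 r0 h1 h2 /andP[h3 h4].
by apply/andP; split; nra.
Qed.

Lemma measurable_G x i : X x -> measurable_fun [set: Xi] (fun z => G x z 0 i).
Proof.
by move=> Xx; have /integrableP[/measurable_EFinP] := oracle_G_integrable oracle Xx i.
Qed.

Lemma measurable_F x : X x -> measurable_fun [set: Xi] (F x).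
Proof.
by move=> Xx; have /integrableP[/measurable_EFinP] := oracle_F_integrable oracle Xx.
Qed.

Section Composition.
Context {d : measure_display} {T : measurableType d}.
Context (U : T -> 'rV[R]_n) (Z : T -> Xi).
Hypotheses (XU : forall t, X (U t)) (mU : mvec U).

Lemma mvec_gradf : mvec (fun t => gradf (U t)).
Proof.
move=> i; apply: (@measurable_caratheodory _ _ _ T X
  (fun x _ => gradf x 0 i) (cst L) U) => //.
move=> t x y Xx Xy; apply: le_trans (objective_lipschitz f_smooth Xx Xy).
by have := norm_coord_le_enorm (gradf x - gradf y) i; rewrite !mxE.
Qed.

Lemma measurable_f : measurable_fun [set: T] (fun t => f (U t)).
Proof.
have [[t0 _]|noT] := pselect (exists t : T, True); last first.
  rewrite (_ : [set: T] = set0); first exact: measurable_fun_set0.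
  by apply/seteqP; split=> // t _; case: noT; exists t.
apply: (@measurable_caratheodory _ _ _ T X
  (fun x _ => f x) (cst (Lip_f (U t0))) U) => //.
by move=> t x y Xx Xy; exact: objective_fun_lipschitz.
Qed.

Hypothesis mZ : measurable_fun [set: T] Z.

Lemma mvec_G : mvec (fun t => G (U t) (Z t)).
Proof.
move=> i; apply: (@measurable_caratheodory _ _ _ T X
  (fun x t => G x (Z t) 0 i) (Lxi \o Z) U) => //.
- exact: (measurableT_comp (oracle_Lxi_measurable oracle) mZ).
- by move=> x Xx; exact: (measurableT_comp (measurable_G x i Xx) mZ).
- move=> t x y Xx Xy.
  apply: le_trans (oracle_G_lipschitz oracle (Z t) Xx Xy).
  by have := norm_coord_le_enorm (G x (Z t) - G y (Z t)) i; rewrite !mxE.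
Qed.

Lemma measurable_F_comp : measurable_fun [set: T] (fun t => F (U t) (Z t)).
Proof.
have [[t0 _]|noT] := pselect (exists t : T, True); last first.
  rewrite (_ : [set: T] = set0); first exact: measurable_fun_set0.
  by apply/seteqP; split=> // t _; case: noT; exists t.
apply: (@measurable_caratheodory _ _ _ T X (fun x t => F x (Z t))
  (fun t => enorm (G (U t0) (Z t))
     + (Lxi (Z t) + 3 / 2 * Lxi (Z t)) * ediam X) U) => //.
- have mL : measurable_fun [set: T] (fun t => Lxi (Z t)).
    exact: (measurableT_comp (oracle_Lxi_measurable oracle) mZ).
  apply: measurable_funD.
    apply: measurable_enorm => i.
    exact: (measurableT_comp (measurable_G (U t0) i (XU t0)) mZ).
  apply: measurable_funM => //; apply: measurable_funD => //.
  exact: measurable_funM.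
- by move=> x Xx; exact: (measurableT_comp (measurable_F x Xx) mZ).
- move=> t x y Xx Xy; have Lz := oracle_Lxi_ge0 oracle (Z t).
  apply: (@lipschitz_of_bregman _ _ X (F ^~ (Z t)) (G ^~ (Z t))
    (3 / 2 * Lxi (Z t)) (Lxi (Z t)) (U t0)) => //.
  + by rewrite mulr_ge0.
  + by move=> u v Xu; apply: enormB_le_ediam => //; exists u.
  + by move=> u v; exact: (oracle_G_lipschitz oracle).
  + by move=> u v; exact: normr_bregman_sample.
Qed.

End Composition.

Lemma centered_G x : X x -> centered mu (fun z => G x z - gradf x).
Proof.
move=> Xx.
have iG i := oracle_G_integrable oracle Xx i.
have icst i : mu.-integrable [set: Xi] (fun=> (gradf x 0 i)%:E).
  exact: finite_measure_integrable_cst.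
split=> [i|i|].
- under eq_fun do rewrite !mxE EFinB.
  exact: integrableB.
- under eq_integral do rewrite !mxE EFinB.
  rewrite integralB// integral_cst//.
  rewrite [X in (_ - _ * X)%E](_ : _ = 1%E); last exact: probability_setT.
  have := oracle_G_unbiased oracle Xx i; rewrite unlock => ->.
  by rewrite mule1 subee.
- apply/integrableP; split.
    apply/measurable_EFinP/measurable_funX/measurable_enorm.
    apply: mvecB; first by move=> i; exact: measurable_G.
    exact: mvec_cst.
  under eq_integral do rewrite gee0_abs ?lee_fin ?sqr_ge0//.
  have := oracle_variance oracle Xx; rewrite unlock => /le_lt_trans; apply.
  exact: ltry.
Qed.

Lemma centeredB (Y Z : Xi -> 'rV[R]_n) :
  centered mu Y -> centered mu Z -> centered mu (fun z => Y z - Z z).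
Proof.
move=> [iY Y0 iY2] [iZ Z0 iZ2]; split=> [i|i|].
- under eq_fun do rewrite !mxE EFinB.
  exact: integrableB.
- under eq_integral do rewrite !mxE EFinB.
  by rewrite integralB// Y0 Z0 sube0.
- have mvec_of (V : Xi -> 'rV[R]_n) :
      (forall i, mu.-integrable [set: Xi] (fun z => (V z 0 i)%:E)) -> mvec V.
    by move=> iV i; have /integrableP[/measurable_EFinP] := iV i.
  have i2 : mu.-integrable [set: Xi]
      (fun z => (2%:E * ((enorm (Y z) ^+ 2)%:E + (enorm (Z z) ^+ 2)%:E))%E).
    by apply: integrableZl => //; exact: integrableD.
  apply: (le_integrable _ _ _ i2) => //.
    apply/measurable_EFinP/measurable_funX/measurable_enorm.
    by apply: mvecB; exact: mvec_of.
  move=> z _; rewrite -EFinD -EFinM !abse_EFin lee_fin.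
  rewrite ger0_norm ?sqr_ge0// ger0_norm ?mulr_ge0 ?addr_ge0 ?sqr_ge0//.
  rewrite !enorm_sqr !edotE (edotC (Z z) (Y z)).
  have := edot_ge0 (Y z + Z z); rewrite !edotE (edotC (Z z) (Y z)); lra.
Qed.

Lemma centered_GB x y : X x -> X y ->
  centered mu (fun z => (G x z - G y z) - (gradf x - gradf y)).
Proof.
move=> Xx Xy; have := centeredB _ _ (centered_G x Xx) (centered_G y Xy).
rewrite (_ : (fun _ => _) = (fun z => G x z - G y z - (gradf x - gradf y)))//.
by apply/funext => z; apply/rowP => i; rewrite !mxE; ring.
Qed.

Lemma bregman_unbiased x y : X x -> X y ->
  mu.-integrable [set: Xi] (fun z => (bregman (F ^~ z) (G ^~ z) x y)%:E) /\
  (\int[mu]_z (bregman (F ^~ z) (G ^~ z) x y)%:E = (bregman f gradf x y)%:E)%E.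
Proof.
move=> Xx Xy.
have iFx := oracle_F_integrable oracle Xx; have iFy := oracle_F_integrable oracle Xy.
have iG i := oracle_G_integrable oracle Xy i.
have iGZ i : mu.-integrable [set: Xi]
    (fun z => ((x - y) 0 i)%:E * (G y z 0 i)%:E)%E by exact: integrableZl.
have E : (fun z => (bregman (F ^~ z) (G ^~ z) x y)%:E) =
  (fun z => ((F x z)%:E - (F y z)%:E)
    - \sum_(i < n) (((x - y) 0 i)%:E * (G y z 0 i)%:E))%E.
  apply/funext => z; under eq_bigr do rewrite -EFinM.
  rewrite sumEFin -!EFinB; congr EFin; rewrite /bregman; congr (_ - _).
  by apply: eq_bigr => i _; rewrite mulrC.
rewrite E; split.
  by apply: integrableB => //; [exact: integrableB|exact: integrable_sum].
rewrite integralB//; [|exact: integrableB|exact: integrable_sum].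
rewrite integralB// integral_sum//.
have := oracle_F_unbiased oracle Xx; have := oracle_F_unbiased oracle Xy.
rewrite unlock => -> ->.
under eq_bigr do rewrite integralZl//.
have Gu i : (\int[mu]_z (G y z 0 i)%:E = (gradf y 0 i)%:E)%E.
  by have := oracle_G_unbiased oracle Xy i; rewrite unlock.
under eq_bigr do rewrite Gu -EFinM.
rewrite sumEFin -!EFinB; congr EFin; rewrite /bregman; congr (_ - _).
by apply: eq_bigr => i _; rewrite mulrC.
Qed.

Lemma integrable_Lxi : 0 <= Lsup -> mu.-integrable [set: Xi] (EFin \o Lxi).
Proof.
move=> Lsup0.
have mL : measurable_fun [set: Xi] (fun z => `|(Lxi z)%:E|%E).
  by apply: measurableT_comp => //; apply/measurable_EFinP/(oracle_Lxi_measurable oracle).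
apply/integrableP; split.
  exact/measurable_EFinP/(oracle_Lxi_measurable oracle).
apply: (@le_lt_trans _ _ (\int[mu]_z (cst (Lsup%:E) z))%E).
  apply: ae_ge0_le_integral => //.
  apply: filterS (oracle_Lxi_sup oracle) => z h _.
  by rewrite /= lee_fin ger0_norm ?(oracle_Lxi_ge0 oracle).
by rewrite integral_cst// [X in (_ * X)%E](_ : _ = 1%E) ?mule1 ?ltry//; exact: probability_setT.
Qed.

End Oracle.

(** * One run of the method, pathwise *)

Section Run.
Context {R : realType} {n : nat} {X : set 'rV[R]_n} {f : 'rV[R]_n -> R}
  {gradf : 'rV[R]_n -> 'rV[R]_n} {L l : R}.
Context {dXi : measure_display} {Xi : measurableType dXi} {mu : probability Xi R}.
Context {F : 'rV[R]_n -> Xi -> R} {G : 'rV[R]_n -> Xi -> 'rV[R]_n}.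
Context {sigma : R} {Lxi : Xi -> R} {Lsup Lms : R}.
Context {k T N : nat} {b b' : nat -> nat} {x0 : 'rV[R]_n} {Lbar0 : R}.
Context {xi xibar : nat -> nat -> Xi} {x Gt : nat -> 'rV[R]_n}
  {Lhat Lbar gamma : nat -> R}.
Hypotheses (X_nonempty : X !=set0) (X_compact : compact X).
Hypothesis X_convex : convex_set (X : set (convex_lmodType 'rV[R]_n)).
Hypothesis oracle : stochastic_oracle mu X f gradf F G sigma Lxi Lsup Lms.
Hypotheses (x0_in : X x0) (Lbar0_gt0 : 0 < Lbar0).
Hypothesis run :
  AC_VR_SPG_run X F G k T N b b' x0 Lbar0 xi xibar x Gt Lhat Lbar gamma.

Lemma Lhat_step t : (1 <= t <= k)%N ->
  Lhat t.-1 <= Lhat t /\ Lbar t.-1 <= Lhat t.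
Proof.
move=> tk; have [ep|ep] := boolP (epoch_start T t).
  have [_ ->] := run_epoch_start run tk ep.
  by rewrite !le_max !lexx orbT.
have [_ ->] := run_epoch_inner run tk ep.
by rewrite !le_max !lexx ?orbT.
Qed.

Lemma Lhat_ge t : (t <= k)%N -> Lbar0 <= Lhat t.
Proof.
elim: t => [_|t IH tk]; first by rewrite (run_Lhat0 run).
have [h _] := @Lhat_step t.+1 tk.
by apply: le_trans h; exact/IH/ltnW.
Qed.

Lemma Lhat_gt0 t : (t <= k)%N -> 0 < Lhat t.
Proof. by move=> tk; exact: lt_le_trans (Lhat_ge t tk). Qed.

Lemma gamma_gt0 t : (1 <= t <= k)%N -> 0 < gamma t.
Proof.
move=> tk; rewrite (run_gamma run tk) mulr_gt0// Lhat_gt0//.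
by have /andP[] := tk.
Qed.

Lemma iterate_in t : (t <= k)%N -> X (x t).
Proof.
case: t => [_|t tk]; first by rewrite (run_x0 run).
by rewrite (run_step run (t := t.+1))//; exact: prox_step_in.
Qed.

Lemma pred_leq t : (1 <= t <= k)%N -> (t.-1 <= k)%N.
Proof. by move=> /andP[_]; apply: leq_trans; exact: leq_pred. Qed.

(** This is what the curvature estimate of an inner iteration is designed for:
    it converts the observed gradient increments into a step length. *)
Lemma increments_le_Lhat t : (1 < t <= k)%N -> ~~ epoch_start T t ->
  (b t)%:R^-1 *
    \sum_(i < b t) enorm (G (x t.-1) (xi t i) - G (x t.-2) (xi t i)) ^+ 2
  <= Lhat t ^+ 2 * enorm (x t.-1 - x t.-2) ^+ 2.
Proof.
move=> /andP[t1 tk] ep; have t1k : (1 <= t <= k)%N by rewrite (ltnW t1).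
set S := \sum_(_ < _) _; set r := enorm _ ^+ 2.
have [r0|r0] := eqVneq r 0.
  rewrite r0 mulr0 /S big1 ?mulr0// => i _.
  have X1 := iterate_in t.-1 (pred_leq t t1k).
  have X2 : X (x t.-2) by apply: iterate_in; rewrite (leq_trans (leq_pred _))// pred_leq.
  have := oracle_G_lipschitz oracle (xi t i) X1 X2.
  move/eqP: r0; rewrite sqrf_eq0 => /eqP ->; rewrite mulr0 => le0.
  by apply/eqP; rewrite sqrf_eq0 eq_le le0 enorm_ge0.
have rp : 0 < r by rewrite lt_neqAle eq_sym r0 sqr_ge0.
have [_ LE] := run_epoch_inner run t1k ep.
have S0 : 0 <= S by apply: sumr_ge0 => i _; exact: sqr_ge0.
have q0 : 0 <= S / ((b t)%:R * r) by rewrite divr_ge0// mulr_ge0// ltW.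
have le_sqrt : Num.sqrt (S / ((b t)%:R * r)) <= Lhat t.
  by rewrite LE le_max lexx orbT.
have : Num.sqrt (S / ((b t)%:R * r)) ^+ 2 <= Lhat t ^+ 2.
  by rewrite ler_pXn2r ?nnegrE ?sqrtr_ge0 ?(ltW (Lhat_gt0 _ tk)).
clear LE; clearbody S r; rewrite sqr_sqrtr// -(ler_pM2r rp); apply: le_trans.
by rewrite invfM mulrA divfK// mulrC.
Qed.

(** By construction the curvature estimate is the one for which the sampled
    first-order expansion is exact. *)
Lemma Lbar_bregman t : (1 <= t <= k)%N ->
  Lbar t * enorm (x t - x t.-1) ^+ 2 / 2 =
  (b' t)%:R^-1 * \sum_(i < b' t)
     bregman (F ^~ (xibar t i)) (G ^~ (xibar t i)) (x t) (x t.-1).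
Proof.
move=> tk; rewrite (run_Lbar run tk); cbv zeta.
set B := _ * \sum_(i < b' t) bregman _ _ _ _.
have -> : (b' t)%:R^-1 * (\sum_(i < b' t) F (x t) (xibar t i))
  - (b' t)%:R^-1 * (\sum_(i < b' t) F (x t.-1) (xibar t i))
  - edot ((b' t)%:R^-1 *: \sum_(i < b' t) G (x t.-1) (xibar t i))
         (x t - x t.-1) = B.
  by rewrite /B edotZl edot_suml -!mulrBr -!sumrB.
have [r0|r0] := eqVneq (enorm (x t - x t.-1) ^+ 2) 0; last first.
  by rewrite divfK// mulrC mulKf ?pnatr_eq0.
rewrite r0 mulr0 mul0r /B big1 ?mulr0// => i _.
move/eqP: r0; rewrite sqrf_eq0 => /eqP/enorm_eq0/subr0_eq ->.
by rewrite /bregman !subrr edot0r subrr.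
Qed.

(** The projected gradient differs from gamma times the step by at most the
    error of the gradient estimate, and the variational inequality at the
    previous iterate bounds the step. The constants come from
    |u + v|^2 <= 2 |u|^2 + 2 |v|^2 and from a b <= M a^2 + b^2 / (4 M), with
    gamma = 4 M. *)
Lemma descent_step t : (1 <= t <= k)%N ->
  (4 * gamma t)^-1 *
    enorm (proj_grad X (x t.-1) (gradf (x t.-1)) (gamma t)) ^+ 2
  + Lhat t * enorm (x t - x t.-1) ^+ 2
  <= - edot (gradf (x t.-1)) (x t - x t.-1)
     + 3 / 8 * ((Lhat t)^-1 * enorm (Gt t - gradf (x t.-1)) ^+ 2).
Proof.
move=> tk; have t_le : (t <= k)%N by have /andP[] := tk.
have M0 := Lhat_gt0 t t_le; have gE := run_gamma run tk.
have g0 := gamma_gt0 t tk; have xE := run_step run tk.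
have Xp := iterate_in t.-1 (pred_leq t tk).
set M := Lhat t in M0 gE *; set h := gradf (x t.-1).
set p := prox_step X (x t.-1) h (gamma t).
have var := prox_step_variational X X_nonempty X_compact X_convex
  (x t.-1) (Gt t) (gamma t) (x t.-1) Xp.
have lip := prox_step_lipschitz X X_nonempty X_compact X_convex
  (x t.-1) h (Gt t) (gamma t) g0.
rewrite -xE -/p in var lip.
have pgE : proj_grad X (x t.-1) h (gamma t)
    = - (gamma t *: (x t - x t.-1) + gamma t *: (p - x t)).
  by rewrite /proj_grad -/p -scalerDr -scalerN [x t - _ + _]addrC subrKA opprB.
have dx : x t.-1 - x t = - (x t - x t.-1) by rewrite opprB.
have GtE : Gt t = h + (Gt t - h) by rewrite addrC subrK.
rewrite pgE enormN; rewrite dx {1}GtE in var; rewrite (enormB h) in lip.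
move: (Gt t - h) (x t - x t.-1) (p - x t) lip var => dl D e lip var.
(* The two squares behind these elementary inequalities. *)
have eD := edot_ge0 (D - e); have dD := edot_ge0 ((2 * M) *: D + dl).
have lip2 : gamma t ^+ 2 * edot e e <= edot dl dl.
  rewrite -!enorm_sqr -exprMn ler_pXn2r ?nnegrE ?enorm_ge0//.
  by rewrite mulr_ge0 ?enorm_ge0// ltW.
rewrite !enorm_sqr; move: var eD dD lip2; rewrite !edotE gE.
rewrite (edotC e D) (edotC dl D).
move: (edot D D) (edot e e) (edot D e) (edot D dl) (edot dl dl) (edot h D).
move=> a c u v q w var sqB sqD lip2.
have Mn0 : M != 0 by rewrite gt_eqF.
set r := M^-1 * q; have qE : q = M * r by rewrite /r mulrA divff// mul1r.
have {}sqD : 0 <= 4 * M * a + 4 * v + r.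
  by rewrite -(pmulr_rge0 _ M0); move: sqD; rewrite qE; lra.
have {}lip2 : 16 * M * c <= r.
  by rewrite -(ler_pM2l M0); move: lip2; rewrite qE; lra.
rewrite (_ : _^-1 * _ = M * (a + 2 * u + c)); last by field.
have := mulr_ge0 (ltW M0) sqB; clearbody r; lra.
Qed.

(** The estimate is twice an average of sampled remainders divided by the squared
    step, and each of these is bounded through the modulus of its sample. *)
Lemma Lbar_le t : (1 <= t <= k)%N -> (0 < b' t)%N ->
  (forall i, (i < b' t)%N -> Lxi (xibar t i) <= Lsup) -> 0 <= Lsup ->
  Lbar t <= Lsup.
Proof.
move=> tk b0 hL Lsup0.
have t_le : (t <= k)%N by have /andP[] := tk.
have [r0|r0] := eqVneq (enorm (x t - x t.-1) ^+ 2) 0.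
  by rewrite (run_Lbar run tk); cbv zeta; rewrite r0 invr0 mulr0.
have rp : 0 < enorm (x t - x t.-1) ^+ 2 by rewrite lt_neqAle eq_sym r0 sqr_ge0.
rewrite -(ler_pM2r rp) -(@ler_pM2r _ 2^-1)// Lbar_bregman//.
rewrite ler_pdivrMl ?ltr0n//.
apply: (@le_trans _ _ (\sum_(i < b' t) (Lsup * enorm (x t - x t.-1) ^+ 2 / 2))).
  apply: ler_sum => i _.
  apply: le_trans (oracle_F_upper_curvature oracle _ (iterate_in t t_le)
    (iterate_in t.-1 (pred_leq t tk))) _.
  by rewrite mulrAC ler_pM2r// ler_wpM2r ?sqr_ge0 ?hL.
by rewrite sumr_const card_ord mulr_natl.
Qed.

Lemma Lhat_le t : (t <= k)%N -> (forall t, 0 < b t)%N -> (forall t, 0 < b' t)%N ->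
  Lbar0 <= Lsup ->
  (forall t i, (1 <= t <= k)%N -> ~~ epoch_start T t -> (i < b t)%N ->
    Lxi (xi t i) <= Lsup) ->
  (forall t i, (1 <= t <= k)%N -> (i < b' t)%N -> Lxi (xibar t i) <= Lsup) ->
  Lhat t <= Lsup.
Proof.
move=> tk b0 b'0 LL hxi hbar.
have Lsup0 : 0 <= Lsup by apply: le_trans LL; exact: ltW.
elim: t tk => [_|t IH tk]; first by rewrite (run_Lhat0 run).
have Lt : Lbar t <= Lsup.
  case: t {IH} tk => [_|t tk]; first by rewrite (run_Lbar0 run).
  have tk1 : (1 <= t.+1 <= k)%N by apply/andP; split => //; exact: ltnW.
  by apply: Lbar_le => // i; exact: hbar.
have LM := IH (ltnW tk).
have t1k : (1 <= t.+1 <= k)%N by [].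
have [ep|ep] := boolP (epoch_start T t.+1).
  by have [_ ->] := run_epoch_start run t1k ep; rewrite ge_max LM.
have [_ ->] := run_epoch_inner run t1k ep.
rewrite !ge_max LM Lt /=.
have Xt := iterate_in t (ltnW tk).
have Xp : X (x t.-1) by apply: iterate_in; rewrite (leq_trans (leq_pred _))// ltnW.
set r := enorm (x t - x t.-1).
have [r0|r0] := eqVneq r 0; first by rewrite r0 expr0n mulr0 invr0 mulr0 sqrtr0.
have rp : 0 < r by rewrite lt_neqAle eq_sym r0 enorm_ge0.
rewrite -(ger0_norm Lsup0) -sqrtr_sqr ler_wsqrtr//.
rewrite ler_pdivrMr; last by rewrite mulr_gt0 ?ltr0n ?exprn_gt0.
apply: (@le_trans _ _ (\sum_(i < b t.+1) (Lsup * r) ^+ 2)).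
  apply: ler_sum => i _; rewrite ler_pXn2r ?nnegrE ?enorm_ge0//; last first.
    by rewrite mulr_ge0// ltW.
  apply: le_trans (oracle_G_lipschitz oracle _ Xt Xp) _.
  by rewrite ler_wpM2r ?hxi// ltW.
by rewrite sumr_const card_ord -[_ *+ b _]mulr_natl exprMn mulrCA.
Qed.

End Run.

(** * The iterates as functions of the samples *)

Section RunMeasurable.
Context {R : realType} {n : nat} {X : set 'rV[R]_n} {f : 'rV[R]_n -> R}
  {gradf : 'rV[R]_n -> 'rV[R]_n} {L l : R}.
Context {dXi : measure_display} {Xi : measurableType dXi} {mu : probability Xi R}.
Context {F : 'rV[R]_n -> Xi -> R} {G : 'rV[R]_n -> Xi -> 'rV[R]_n}.
Context {sigma : R} {Lxi : Xi -> R} {Lsup Lms : R}.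
Context {k T N : nat} {b b' : nat -> nat} {x0 : 'rV[R]_n} {Lbar0 : R}.
Context {d : measure_display} {A : measurableType d}.
Context {xi xibar : A -> nat -> nat -> Xi} {x Gt : A -> nat -> 'rV[R]_n}
  {Lhat Lbar gamma : A -> nat -> R}.
Hypotheses (X_nonempty : X !=set0) (X_compact : compact X).
Hypothesis X_convex : convex_set (X : set (convex_lmodType 'rV[R]_n)).
Hypothesis f_smooth : smooth_objective X f gradf L l.
Hypothesis oracle : stochastic_oracle mu X f gradf F G sigma Lxi Lsup Lms.
Hypotheses (x0_in : X x0) (Lbar0_gt0 : 0 < Lbar0).
Hypothesis run : forall w, AC_VR_SPG_run X F G k T N b b' x0 Lbar0
  (xi w) (xibar w) (x w) (Gt w) (Lhat w) (Lbar w) (gamma w).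

Let xX w t (tk : (t <= k)%N) : X (x w t) :=
  iterate_in X_nonempty X_compact x0_in (run w) t tk.

Definition known_xi t := forall i, (i < if epoch_start T t then N else b t)%N ->
  measurable_fun [set: A] (fun w => xi w t i).

Definition known_xibar t := forall i, (i < b' t)%N ->
  measurable_fun [set: A] (fun w => xibar w t i).

Let known_iterate t := [/\ mvec (x ^~ t), measurable_fun [set: A] (Lhat ^~ t)
  & (0 < t)%N -> mvec (Gt ^~ t)].

Lemma measurable_Lbar t : (1 <= t <= k)%N -> known_xibar t ->
  mvec (x ^~ t) -> mvec (x ^~ t.-1) -> measurable_fun [set: A] (Lbar ^~ t).
Proof.
move=> tk kx mx mxp; have tle : (t <= k)%N by have /andP[] := tk.
have Xt w := xX w t tle; have Xp w := xX w t.-1 (pred_leq t tk).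
under eq_fun do rewrite (run_Lbar (run _) tk); cbv zeta.
have mD : mvec (fun w => x w t - x w t.-1) by exact: mvecB.
have mF s : mvec (x ^~ s) -> (forall w, X (x w s)) -> measurable_fun [set: A]
    (fun w => \sum_(i < b' t) F (x w s) (xibar w t i)).
  move=> ms Xs; apply: measurable_sum => i.
  by apply: (measurable_F_comp X_compact oracle) => //; exact: kx.
apply: measurable_funM; last first.
  apply: measurable_fun_invr; first by move=> w; exact: sqr_ge0.
  by apply: measurable_funX; exact: measurable_enorm.
apply: measurable_funM => //; apply: measurable_funB.
  apply: measurable_funB; apply: measurable_funM => //; exact: mF.
apply: measurable_edot => //; apply: (mvecZ (cst _)) => //.
apply: mvec_sum => i _.
by apply: (mvec_G oracle) => //; exact: kx.
Qed.

(** The iterate t is a function of the gradient samples up to t and of the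
    curvature samples before t. The sigma-algebra on A is arbitrary, so that
    this applies both to the full sample space and to each past. *)
Lemma run_known t : (t <= k)%N ->
  (forall s, (1 <= s <= t)%N -> known_xi s) ->
  (forall s, (1 <= s < t)%N -> known_xibar s) -> known_iterate t.
Proof.
elim/ltn_ind: t => -[_ _ _ _|t IH tk kxi kxibar].
  split=> //.
    by under eq_fun do rewrite (run_x0 (run _)); exact: mvec_cst.
  by under eq_fun do rewrite (run_Lhat0 (run _)); exact: measurable_cst.
have known s : (s <= t)%N -> known_iterate s.
  move=> st; apply: IH => //; first by rewrite (leq_trans _ tk)// ltnW.
    by move=> u /andP[u1 us]; apply: kxi; rewrite u1 ltnW// ltnS (leq_trans us).
  move=> u /andP[u1 us]; apply: kxibar.
  by rewrite u1 (leq_trans us)// (leq_trans st).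
have [mx mL mG] := known t (leqnn t).
have [mxp _ _] := known t.-1 (leq_pred t).
have t1k : (1 <= t.+1 <= k)%N by [].
have Xt w := xX w t (ltnW tk).
have Xp w : X (x w t.-1) by apply: xX; rewrite (leq_trans (leq_pred _))// ltnW.
have mB : measurable_fun [set: A] (Lbar ^~ t).
  case: (posnP t) => [->|t0].
    by under eq_fun do rewrite (run_Lbar0 (run _)); exact: measurable_cst.
  have tk' : (1 <= t <= k)%N by rewrite t0 ltnW.
  by apply: measurable_Lbar => //; apply: kxibar; rewrite t0 /=.
have kx : known_xi t.+1 by apply: kxi; rewrite /= leqnn.
have mGx s i : (i < if epoch_start T t.+1 then N else b t.+1)%N ->
    mvec (x ^~ s) -> (forall w, X (x w s)) ->
    mvec (fun w => G (x w s) (xi w t.+1 i)).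
  by move=> ib ms Xs; apply: (mvec_G oracle) => //; exact: kx.
have [mGt mLt] : mvec (Gt ^~ t.+1) /\ measurable_fun [set: A] (Lhat ^~ t.+1).
  have [ep|ep] := boolP (epoch_start T t.+1).
    split.
      under eq_fun do rewrite (run_epoch_start (run _) t1k ep).1.
      apply: (mvecZ (cst _)) => //.
      by apply: mvec_sum => i _; apply: mGx => //; rewrite ep.
    under eq_fun do rewrite (run_epoch_start (run _) t1k ep).2.
    exact: measurable_maxr.
  have t0 : (0 < t)%N.
    by rewrite lt0n; apply: contraNneq ep => ->; rewrite /epoch_start dvdn0.
  have mGD i : (i < b t.+1)%N ->
      mvec (fun w => G (x w t) (xi w t.+1 i) - G (x w t.-1) (xi w t.+1 i)).
    by move=> ib; apply: mvecB; apply: mGx => //; rewrite (negbTE ep).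
  split.
    under eq_fun do rewrite (run_epoch_inner (run _) t1k ep).1.
    apply: mvecD; last exact: mG.
    apply: (mvecZ (cst _)) => //.
    by apply: mvec_sum => i _; exact: mGD.
  under eq_fun do rewrite (run_epoch_inner (run _) t1k ep).2.
  apply: measurable_maxr; first exact: measurable_maxr.
  apply: measurable_fun_sqrt.
    move=> w; apply: divr_ge0; last by rewrite mulr_ge0// sqr_ge0.
    by apply: sumr_ge0 => i _; exact: sqr_ge0.
  apply: measurable_funM.
    apply: measurable_sum => i; apply/measurable_funX/measurable_enorm.
    exact: mGD.
  apply: measurable_fun_invr; first by move=> w; rewrite mulr_ge0// sqr_ge0.
  apply: measurable_funM => //.
  by apply/measurable_funX/measurable_enorm/mvecB.
split=> //.
under eq_fun do rewrite (run_step (run _) t1k) (run_gamma (run _) t1k).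
apply: mvec_prox_step => //.
  exact: measurable_funM.
by move=> w; rewrite mulr_gt0// (Lhat_gt0 Lbar0_gt0 (run w)).
Qed.

End RunMeasurable.

(** * Variance of the recursive gradient estimator *)

Definition sample_index : eqType := ((nat * nat) + (nat * nat))%type.

Section DrawnIndices.
Context {k T N : nat} {b b' : nat -> nat}.
(** Independence concerns finite lists of indices, so the drawn samples that
    satisfy J are enumerated. *)
Definition drawn_seq (J : pred sample_index) : seq sample_index :=
  undup [seq j <- [seq inl (t, i) | t <- iota 1 k,
                     i <- iota 0 (if epoch_start T t then N else b t)]
               ++ [seq inr (t, i) | t <- iota 1 k, i <- iota 0 (b' t)]
        | drawn k T N b b' j && J j].

Lemma mem_drawn_seq (J : pred sample_index) j :
  (j \in drawn_seq J) = drawn k T N b b' j && J j.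
Proof.
rewrite mem_undup mem_filter; case: (boolP (drawn _ _ _ _ _ j && J j)) => //= /andP[dj _].
rewrite mem_cat; case: j dj => -[t i] /= /andP[tk ib]; apply/orP.
- left; apply/allpairsPdep; exists t, i.
  by rewrite mem_iota add1n ltnS mem_iota.
- right; apply/allpairsPdep; exists t, i.
  by rewrite mem_iota add1n ltnS mem_iota.
Qed.

Lemma drawn_seq_uniq J : uniq (drawn_seq J).
Proof. exact: undup_uniq. Qed.

Lemma drawn_seq_drawn J : all (drawn k T N b b') (drawn_seq J).
Proof. by apply/allP => j; rewrite mem_drawn_seq => /andP[]. Qed.

(** The samples drawn strictly before the i-th gradient sample, respectively
    the curvature samples, of iteration t. *)
Definition before_xi t i : pred sample_index := fun j =>
  match j with
  | inl (s, m) => (s < t)%N || (s == t) && (m < i)%N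
  | inr (s, _) => (s < t)%N
  end.

Definition before_xibar t : pred sample_index := fun j =>
  match j with inl (s, _) => (s <= t)%N | inr (s, _) => (s < t)%N end.

End DrawnIndices.
Arguments drawn_seq : clear implicits.

Section Variance.
Context {R : realType} {n : nat} {X : set 'rV[R]_n} {f : 'rV[R]_n -> R}
  {gradf : 'rV[R]_n -> 'rV[R]_n} {L l : R}.
Context {dXi : measure_display} {Xi : measurableType dXi} {mu : probability Xi R}.
Context {F : 'rV[R]_n -> Xi -> R} {G : 'rV[R]_n -> Xi -> 'rV[R]_n}.
Context {sigma : R} {Lxi : Xi -> R} {Lsup Lms : R}.
Context {k T N : nat} {b b' : nat -> nat} {x0 : 'rV[R]_n} {Lbar0 : R}.
Context {d : measure_display} {Omega : measurableType d} {P : probability Omega R}.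
Context {xi xibar : Omega -> nat -> nat -> Xi} {x Gt : Omega -> nat -> 'rV[R]_n}
  {Lhat Lbar gamma : Omega -> nat -> R}.
Hypotheses (X_nonempty : X !=set0) (X_compact : compact X).
Hypothesis X_convex : convex_set (X : set (convex_lmodType 'rV[R]_n)).
Hypothesis f_smooth : smooth_objective X f gradf L l.
Hypothesis oracle : stochastic_oracle mu X f gradf F G sigma Lxi Lsup Lms.
Hypotheses (x0_in : X x0) (Lbar0_gt0 : 0 < Lbar0).
Hypothesis samples_iid :
  iid_family P mu (drawn k T N b b') (sample xi xibar).
Hypothesis run : forall w, AC_VR_SPG_run X F G k T N b b' x0 Lbar0
  (xi w) (xibar w) (x w) (Gt w) (Lhat w) (Lbar w) (gamma w).

Let xX w t (tk : (t <= k)%N) : X (x w t) :=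
  iterate_in X_nonempty X_compact x0_in (run w) t tk.

Local Notation pastJ J := (past (sample xi xibar) (drawn_seq k T N b b' J)).

Definition grad_error w t := Gt w t - gradf (x w t.-1).

Lemma known_xi_past (J : pred sample_index) t :
  (1 <= t <= k)%N -> (forall i, J (inl (t, i))) ->
  @known_xi _ _ T N b _ (pastJ J) xi t.
Proof.
move=> tk Jt i ib.
apply: (measurable_sample_past (sample xi xibar) _ (inl (t, i))).
by rewrite mem_drawn_seq /= tk ib Jt.
Qed.

Lemma known_xibar_past (J : pred sample_index) t :
  (1 <= t <= k)%N -> (forall i, J (inr (t, i))) ->
  @known_xibar _ _ b' _ (pastJ J) xibar t.
Proof.
move=> tk Jt i ib.
apply: (measurable_sample_past (sample xi xibar) _ (inr (t, i))).
by rewrite mem_drawn_seq /= tk ib Jt.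
Qed.

Lemma known_before_xi t i : (1 <= t <= k)%N -> let A := pastJ (before_xi t i) in
  [/\ @mvec _ _ _ A (x ^~ t.-1), @mvec _ _ _ A (x ^~ t.-2),
      measurable_fun [set: A] (Lhat ^~ t.-1)
    & (1 < t)%N -> @mvec _ _ _ A (Gt ^~ t.-1)].
Proof.
move=> tk A.
have known s : (s < t)%N -> [/\ @mvec _ _ _ A (x ^~ s),
    measurable_fun [set: A] (Lhat ^~ s) & (0 < s)%N -> @mvec _ _ _ A (Gt ^~ s)].
  move=> st; have sk : (s <= k)%N.
    by have /andP[_] := tk; apply: leq_trans; exact: ltnW.
  apply: (run_known X_nonempty X_compact X_convex oracle x0_in Lbar0_gt0 run
    (A := A)) => // u /andP[u1 us].
  - apply: known_xi_past; first by rewrite u1 (leq_trans us).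
    by move=> j; rewrite /= (leq_ltn_trans us).
  - apply: known_xibar_past; first by rewrite u1 (leq_trans _ sk)// ltnW.
    by move=> j; rewrite /= (ltn_trans us).
have t0 : (t.-1 < t)%N by case/andP: tk => t1 _; rewrite prednK.
have [mx mL mG] := known t.-1 t0.
have [mxp _ _] := known t.-2 (leq_ltn_trans (leq_pred _) t0).
by split=> // t1; apply: mG; rewrite -ltnS prednK// ltnW.
Qed.

Lemma fresh_xi t i : inl (t, i) \notin drawn_seq k T N b b' (before_xi t i).
Proof. by rewrite mem_drawn_seq /= !ltnn andbF andbF. Qed.

(** At the start of an epoch the error is an average of N independent centered
    errors; they are added one at a time. *)
Lemma variance_epoch_start t : (1 <= t <= k)%N -> epoch_start T t ->
  (0 < N)%N ->
  (\int[P]_w (enorm (grad_error w t) ^+ 2)%:E <= (sigma ^+ 2 / N%:R)%:E)%E.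
Proof.
move=> tk ep N0.
have Xp w := xX w t.-1 (pred_leq t tk).
pose H w z := G (x w t.-1) z - gradf (x w t.-1).
pose V i w := N%:R^-1 *: \sum_(j < i) H w (xi w t j).
have VS i w : V i.+1 w = V i w + N%:R^-1 *: H w (xi w t i).
  by rewrite /V big_ord_recr scalerDr.
have VN w : grad_error w t = V N w.
  rewrite /grad_error (run_epoch_start (run w) tk ep).1 /V /H sumrB scalerBr.
  rewrite sumr_const card_ord -[gradf _ *+ N]scaler_nat scalerA mulVf ?scale1r//.
  by rewrite pnatr_eq0 -lt0n.
suff main i : (i <= N)%N ->
    (\int[P]_w (enorm (V i w) ^+ 2)%:E
      <= (i%:R * ((N%:R^-1) ^+ 2 * sigma ^+ 2))%:E)%E.
  under eq_integral do rewrite VN.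
  apply: le_trans (main N (leqnn N)) _; rewrite lee_fin.
  by rewrite expr2 mulrA mulrA divff ?mul1r 1?mulrC// pnatr_eq0 -lt0n.
elim: i => [_|i IH iN].
  rewrite mul0r; under eq_integral do rewrite /V big_ord0 scaler0 enorm0 expr0n.
  by rewrite integral0.
set J := before_xi t i.
have [mx _ _ _] := known_before_xi t i tk; rewrite -/J in mx.
have mgrad : @mvec _ _ _ (pastJ J) (fun w => gradf (x w t.-1)).
  exact: (mvec_gradf f_smooth).
have mV : @mvec _ _ _ (pastJ J) (V i).
  apply: (mvecZ (cst _)) => //; apply: mvec_sum => j _; apply: mvecB => //.
  apply: (mvec_G oracle) => //.
  apply: (measurable_sample_past (sample xi xibar) _ (inl (t, j : nat))).
  by rewrite mem_drawn_seq /= tk ep eqxx (ltn_trans (ltn_ord j) iN) ltn_ord orbT.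
have mH : mvec (fun u : pastJ J * Xi => H u.1 u.2).
  apply: mvecB; last exact: (mvec_comp _ _ measurable_fst mgrad).
  apply: (mvec_G oracle (fun u : pastJ J * Xi => x u.1 t.-1) snd) => //.
  exact: (mvec_comp _ _ measurable_fst mx).
have cH w : centered mu (H w) by exact: (centered_G oracle).
have Dj : drawn k T N b b' (inl (t, i)) by rewrite /= tk ep.
have := integral_sqr_increment mu P _ _ samples_iid _ (drawn_seq_uniq J)
  (drawn_seq_drawn J) _ (fresh_xi t i) Dj (cst 1) (V i) H N%:R^-1
  (fun=> ler01) (measurable_cst _) mV mH cH.
under eq_integral do rewrite /= mul1r -VS.
under [X in _ = (X + _)%E -> _]eq_integral do rewrite /= mul1r.
under [X in _ = (_ + _ * X)%E -> _]eq_integral do rewrite /= mul1r.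
move=> ->.
rewrite -[i.+1]addn1 natrD mulrDl EFinD; apply: leeD; first exact/IH/ltnW.
rewrite mul1r [leRHS]EFinM; apply: lee_wpmul2l; first by rewrite lee_fin sqr_ge0.
have mphi : measurable_fun [set: pastJ J * Xi]
    (fun u => (enorm (H u.1 u.2) ^+ 2)%:E).
  exact/measurable_EFinP/measurable_funX/measurable_enorm.
have := tonelli_past P mu _ _ samples_iid _ (drawn_seq_uniq J)
  (drawn_seq_drawn J) _ _ (fresh_xi t i) Dj mphi.
move=> /= ->; last by move=> u; rewrite lee_fin sqr_ge0.
apply: (@le_trans _ _ (\int[P]_w (cst (sigma ^+ 2)%:E w))%E).
  apply: ge0_le_integral => //.
  - by move=> w _; apply: integral_ge0 => z _; rewrite lee_fin sqr_ge0.
  - have := measurable_fun_fubini_tonelli_F (m2 := mu) _ mphi.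
    move=> h; apply: (measurableT_comp (h _)
      (measurable_past P mu _ _ samples_iid _ (drawn_seq_drawn J))).
    by move=> u; rewrite lee_fin sqr_ge0.
  - by move=> w _; have := oracle_variance oracle (Xp w); rewrite unlock.
by rewrite integral_cst// [X in (_ * X)%E](_ : _ = 1%E) ?mule1//; exact: probability_setT.
Qed.

Lemma known_omega t : (t <= k)%N -> [/\ mvec (x ^~ t),
  measurable_fun [set: Omega] (Lhat ^~ t) & (0 < t)%N -> mvec (Gt ^~ t)].
Proof.
move=> tk.
apply: (run_known X_nonempty X_compact X_convex oracle x0_in Lbar0_gt0 run) => //.
- move=> s /andP[s1 st] i ib.
  have := iid_measurable samples_iid (j := inl (s, i)).
  by apply; rewrite /= s1 ib (leq_trans st).
- move=> s /andP[s1 st] i ib.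
  have := iid_measurable samples_iid (j := inr (s, i)).
  by apply; rewrite /= s1 ib (leq_trans _ tk)// ltnW.
Qed.

(** The weight is the reciprocal of the previous curvature estimate, which does
    not involve the new samples; it dominates the reciprocal of the current one
    because the estimates increase. *)
Lemma variance_epoch_inner t : (1 < t <= k)%N -> ~~ epoch_start T t ->
  (0 < b t)%N ->
  (\int[P]_w ((Lhat w t)^-1 * enorm (grad_error w t) ^+ 2)%:E
   <= \int[P]_w ((Lhat w t.-1)^-1 * enorm (grad_error w t.-1) ^+ 2)%:E
      + ((b t)%:R^-1)%:E * \int[P]_w ((Lhat w t.-1)^-1 *
          (Lhat w t ^+ 2 * enorm (x w t.-1 - x w t.-2) ^+ 2))%:E)%E.
Proof.
move=> /andP[t1 tle] ep b0.
have tk : (1 <= t <= k)%N by rewrite (ltnW t1).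
have tk1 : (t.-1 <= k)%N := pred_leq t tk.
have tk2 : (t.-2 <= k)%N := leq_trans (leq_pred _) tk1.
have Xp w := xX w t.-1 tk1; have Xpp w := xX w t.-2 tk2.
have t10 : (0 < t.-1)%N by rewrite -ltnS prednK// ltnW.
pose a w := (Lhat w t.-1)^-1.
have M0 w s : (s <= k)%N -> 0 < Lhat w s := Lhat_gt0 Lbar0_gt0 (run w) s.
have a0 w : 0 <= a w by rewrite invr_ge0 ltW// M0.
pose GD w z := G (x w t.-1) z - G (x w t.-2) z.
pose gD w := gradf (x w t.-1) - gradf (x w t.-2).
pose H w z := GD w z - gD w.
pose c := (b t)%:R^-1 : R.
have c0 : 0 <= c by rewrite invr_ge0.
pose V i w := grad_error w t.-1 + c *: \sum_(j < i) H w (xi w t j).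
have VS i w : V i.+1 w = V i w + c *: H w (xi w t i).
  by rewrite /V big_ord_recr scalerDr addrA.
have VN w : grad_error w t = V (b t) w.
  rewrite /grad_error (run_epoch_inner (run w) tk ep).1 /V /H [in RHS]sumrB.
  rewrite sumr_const card_ord -[gD w *+ b t]scaler_nat scalerBr scalerA.
  rewrite mulVf ?scale1r; last by rewrite pnatr_eq0 -lt0n.
  rewrite /gD /grad_error -/(c) /GD.
  by apply/rowP => i; rewrite !mxE; ring.
have sq_ge0 w (v : 'rV[R]_n) : (0 <= (a w * enorm v ^+ 2)%:E)%E.
  by rewrite lee_fin mulr_ge0// sqr_ge0.
have main i : (i <= b t)%N ->
    (\int[P]_w (a w * enorm (V i w) ^+ 2)%:E
      <= \int[P]_w (a w * enorm (grad_error w t.-1) ^+ 2)%:E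
        + (c ^+ 2)%:E *
          \sum_(j < i) \int[P]_w (a w * enorm (GD w (xi w t j)) ^+ 2)%:E)%E.
  elim: i => [_|i IH iN].
    under eq_integral do rewrite /V big_ord0 scaler0 addr0.
    by rewrite big_ord0 mule0 adde0.
  set J := before_xi t i.
  have := known_before_xi t i tk; rewrite -/J => -[mx mxp mL mG].
  have mgD : @mvec _ _ _ (pastJ J) gD by apply: mvecB; exact: (mvec_gradf f_smooth).
  have mS : measurable_fun [set: pastJ J * Xi] (snd : pastJ J * Xi -> Xi).
    exact: measurable_snd.
  have ma : measurable_fun [set: pastJ J] (a : pastJ J -> R).
    by apply: measurable_fun_invr => // w; rewrite ltW// M0.
  have mH : mvec (fun u : pastJ J * Xi => H u.1 u.2).
    apply: mvecB; last exact: (mvec_comp _ _ measurable_fst mgD).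
    apply: mvecB.
      apply: (mvec_G oracle (fun u : pastJ J * Xi => x u.1 t.-1) snd) => //.
      exact: (mvec_comp _ _ measurable_fst mx).
    apply: (mvec_G oracle (fun u : pastJ J * Xi => x u.1 t.-2) snd) => //.
    exact: (mvec_comp _ _ measurable_fst mxp).
  have mV : @mvec _ _ _ (pastJ J) (V i).
    apply: mvecD.
      apply: mvecB; last exact: (mvec_gradf f_smooth).
      exact: mG.
    apply: (mvecZ (cst _)) => //; apply: mvec_sum => j _; apply: mvecB => //.
    have mj : measurable_fun [set: pastJ J] (fun w => xi w t j).
      apply: (measurable_sample_past (sample xi xibar) _ (inl (t, j : nat))).
      rewrite mem_drawn_seq /= tk (negbTE ep) eqxx (ltn_trans (ltn_ord j) iN).
      by rewrite ltn_ord orbT.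
    by apply: mvecB; apply: (mvec_G oracle).
  have cH w : centered mu (H w) by exact: (centered_GB oracle).
  have Dj : drawn k T N b b' (inl (t, i)) by rewrite /= tk (negbTE ep).
  have orth S c' mS' := integral_sqr_increment mu P _ _ samples_iid _
    (drawn_seq_uniq J) (drawn_seq_drawn J) _ (fresh_xi t i) Dj a S H c'
    a0 ma mS' mH cH.
  have := orth (V i) c mV.
  under eq_integral do rewrite /= -VS.
  move=> ->; rewrite big_ord_recr [X in (_ <= _ + X)%E]ge0_muleDr; last 2 first.
  - by apply: sume_ge0 => j _; exact: integral_ge0.
  - exact: integral_ge0.
  rewrite addeA; apply: leeD; first exact/IH/ltnW.
  apply: lee_wpmul2l; first by rewrite lee_fin sqr_ge0.
  (* Orthogonality again: centering a vector only lowers its mean square. *)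
  have := orth gD 1 mgD.
  under eq_integral do rewrite /= scale1r addrC subrK.
  move=> ->; rewrite expr1n mul1e leeDr//.
  exact: integral_ge0.
have mGD j : (j < b t)%N -> mvec (fun w => GD w (xi w t j)).
  move=> jb; have [mx _ _] := known_omega t.-1 tk1.
  have [mxp _ _] := known_omega t.-2 tk2.
  have mj : measurable_fun [set: Omega] (fun w => xi w t j).
    have := iid_measurable samples_iid (j := inl (t, j)).
    by apply; rewrite /= tk (negbTE ep).
  by apply: mvecB; apply: (mvec_G oracle).
have [mx mLp _] := known_omega t.-1 tk1.
have [mxp _ _] := known_omega t.-2 tk2.
have [mxt mL mG] := known_omega t tle.
have ma : measurable_fun [set: Omega] a.
  by apply: measurable_fun_invr => // w; rewrite ltW// M0.
have mV : mvec (V (b t)).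
  rewrite (_ : V (b t) = grad_error ^~ t); last by apply/funext => w; rewrite VN.
  apply: mvecB; first by apply: mG; rewrite ltnW.
  exact: (mvec_gradf f_smooth).
apply: (@le_trans _ _ (\int[P]_w (a w * enorm (V (b t) w) ^+ 2)%:E)%E).
  apply: ge0_le_integral => //.
  - by move=> w _; rewrite lee_fin mulr_ge0 ?sqr_ge0// invr_ge0 ltW// M0.
  - apply/measurable_EFinP/measurable_funM.
      by apply: measurable_fun_invr => // w; rewrite ltW// M0.
    under eq_fun do rewrite VN.
    exact/measurable_funX/measurable_enorm.
  - apply/measurable_EFinP/measurable_funM => //.
    exact/measurable_funX/measurable_enorm.
  - move=> w _; rewrite lee_fin -VN ler_wpM2r ?sqr_ge0//.
    by rewrite lef_pV2 ?posrE ?M0//; have [] := Lhat_step (run w) t tk.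
apply: le_trans (main (b t) (leqnn _)) _; rewrite leeD2l//.
rewrite -ge0_integral_sum//; last first.
  move=> j; apply/measurable_EFinP/measurable_funM => //.
  exact/measurable_funX/measurable_enorm/mGD.
rewrite -ge0_integralZl//; last 3 first.
- apply: emeasurable_sum => j; apply/measurable_EFinP/measurable_funM => //.
  exact/measurable_funX/measurable_enorm/mGD.
- by move=> w _; apply: sume_ge0.
- by rewrite lee_fin sqr_ge0.
rewrite -ge0_integralZl//; last 2 first.
- apply/measurable_EFinP/measurable_funM => //; apply: measurable_funM.
    exact: measurable_funX.
  exact/measurable_funX/measurable_enorm/mvecB.
- move=> w _; rewrite lee_fin; apply: mulr_ge0; first exact: a0.
  by apply: mulr_ge0; exact: sqr_ge0.
apply: ge0_le_integral => //.
- by move=> w _; rewrite mule_ge0 ?lee_fin ?sqr_ge0//; exact: sume_ge0.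
- apply: measurable_funeM; apply: emeasurable_sum => j.
  apply/measurable_EFinP/measurable_funM => //.
  exact/measurable_funX/measurable_enorm/mGD.
- apply: measurable_funeM; apply/measurable_EFinP/measurable_funM => //.
  apply: measurable_funM; first exact: measurable_funX.
  exact/measurable_funX/measurable_enorm/mvecB.
- move=> w _; rewrite sumEFin -!EFinM lee_fin -mulr_sumr.
  rewrite [leLHS](_ : _ = c * (a w * (c * \sum_(j < b t)
    enorm (GD w (xi w t j)) ^+ 2))); last by ring.
  rewrite ler_wpM2l// ler_wpM2l//.
  apply: (increments_le_Lhat X_nonempty X_compact oracle x0_in Lbar0_gt0 (run w)) => //.
  by rewrite t1.
Qed.

End Variance.

(** * Integrals of almost surely bounded functions *)

Section RealIntegrals.
Context {R : realType} {d : measure_display} {Omega : measurableType d}.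
Context {P : probability Omega R}.
Implicit Types (h g : Omega -> R).

Definition L1 h := P.-integrable [set: Omega] (EFin \o h).

Lemma L1D h g : L1 h -> L1 g -> L1 (fun w => h w + g w).
Proof. by move=> ih ig; exact: (integrableD measurableT ih ig). Qed.

Lemma L1B h g : L1 h -> L1 g -> L1 (fun w => h w - g w).
Proof. by move=> ih ig; exact: (integrableB measurableT ih ig). Qed.

Lemma L1Z (c : R) h : L1 h -> L1 (fun w => c * h w).
Proof. by move=> ih; exact: (integrableZl measurableT c ih). Qed.

Lemma L1_cst (c : R) : L1 (fun=> c).
Proof. exact: finite_measure_integrable_cst. Qed.

Lemma L1_sum (I : Type) (r : seq I) (h : I -> Omega -> R) :
  (forall i, L1 (h i)) -> L1 (fun w => \sum_(i <- r) h i w).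
Proof.
move=> ih; elim: r => [|i r IH].
  by under eq_fun do rewrite big_nil; exact: L1_cst.
by under eq_fun do rewrite big_cons; exact: L1D.
Qed.

Lemma L1_le h g : measurable_fun [set: Omega] h -> L1 g ->
  (forall w, `|h w| <= g w) -> L1 h.
Proof.
move=> mh ig hg; apply: (le_integrable _ _ _ ig) => //.
  exact/measurable_EFinP.
by move=> w _; rewrite /= lee_fin (le_trans (hg w))// ler_norm.
Qed.

Lemma L1_ae_bounded h (C : R) : measurable_fun [set: Omega] h ->
  {ae P, forall w, `|h w| <= C} -> L1 h.
Proof.
move=> mh hC; apply/integrableP; split; first exact/measurable_EFinP.
apply: (@le_lt_trans _ _ (\int[P]_w (cst (`|C|%:E) w))%E).
  apply: ae_ge0_le_integral => //.
    by apply: measurableT_comp => //; exact/measurable_EFinP.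
    by move=> w _; rewrite /= lee_fin.
  apply: filterS hC => w h_le _.
  by rewrite /= lee_fin (le_trans h_le)// ler_norm.
by rewrite integral_cst// [X in (_ * X)%E](_ : _ = 1%E) ?mule1 ?ltry//; exact: probability_setT.
Qed.

Lemma L1_ge0 h (C : R) : measurable_fun [set: Omega] h -> (forall w, 0 <= h w) ->
  (\int[P]_w (h w)%:E <= C%:E)%E -> L1 h.
Proof.
move=> mh h0 hC; apply/integrableP; split; first exact/measurable_EFinP.
under eq_integral do rewrite gee0_abs ?lee_fin//.
exact: le_lt_trans hC (ltry _).
Qed.

Lemma L1_EFin h : L1 h -> (\int[P]_w (h w)%:E = (Rintegral P [set: Omega] h)%:E)%E.
Proof.
move=> ih; rewrite /Rintegral fineK//.
exact: (integrable_fin_num measurableT ih).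
Qed.

Lemma ae_le_Rintegral h g : L1 h -> L1 g -> {ae P, forall w, h w <= g w} ->
  Rintegral P [set: Omega] h <= Rintegral P [set: Omega] g.
Proof.
move=> ih ig hg; rewrite -subr_ge0 -RintegralB//.
have mh : measurable_fun [set: Omega] h by have /integrableP[/measurable_EFinP] := ih.
have mg : measurable_fun [set: Omega] g by have /integrableP[/measurable_EFinP] := ig.
(* The difference coincides almost everywhere with its absolute value. *)
rewrite /Rintegral (ae_eq_integral (fun w => `|g w - h w|%:E)).
- by apply: fine_ge0; apply: integral_ge0 => w _; rewrite lee_fin.
- exact: measurableT.
- by apply/measurable_EFinP/measurable_funB.
- by apply/measurable_EFinP; apply: measurableT_comp => //; exact: measurable_funB.
- by apply: filterS hg => w hgw _; rewrite ger0_norm// subr_ge0.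
Qed.

Lemma Rintegral_sum (I : Type) (r : seq I) (h : I -> Omega -> R) :
  (forall i, L1 (h i)) ->
  Rintegral P [set: Omega] (fun w => \sum_(i <- r) h i w)
  = \sum_(i <- r) Rintegral P [set: Omega] (h i).
Proof.
move=> ih; elim: r => [|i r IH].
  by rewrite big_nil; under eq_fun do rewrite big_nil; rewrite Rintegral_cst// mul0r.
rewrite big_cons -IH; under eq_fun do rewrite big_cons.
by rewrite RintegralD//; [exact: ih|exact: L1_sum].
Qed.

End RealIntegrals.

(** An epoch has T iterations, so each increment q enters the errors of at most
    T - 1 later iterations, with weight 1 / T. The invariant keeps the room
    that the rest of the current epoch will need. *)
Lemma epoch_error_sum (R : realType) (k T : nat) (c : R) (e q : nat -> R) :
  (0 < T)%N -> (forall t, 0 <= q t) ->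
  (forall t, (1 <= t <= k)%N -> epoch_start T t -> e t <= c) ->
  (forall t, (1 < t <= k)%N -> ~~ epoch_start T t ->
    e t <= e t.-1 + T%:R^-1 * q t.-1) ->
  \sum_(1 <= t < k.+1) e t <= k%:R * c + \sum_(1 <= t < k.+1) q t.
Proof.
move=> T0 q0 e_start e_inner.
have T0R : 0 < T%:R :> R by rewrite ltr0n.
(* The number of iterations left in the epoch after iteration m + 1. *)
pose room m : R := (T - (m %% T).+1)%:R.
have room0 m : 0 <= room m by [].
have inv m : (m < k)%N -> exists a : R, [/\ 0 <= a, e m.+1 <= c + a &
   \sum_(1 <= t < m.+2) e t + room m * a
     <= m.+1%:R * c + \sum_(1 <= t < m.+1) q t].
  elim: m => [|m IH] mk.
    exists 0; rewrite mulr0 !addr0 big_nat1 big_geq// mul1r addr0.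
    have e1 : e 1%N <= c by apply: e_start => //; rewrite /epoch_start dvdn0.
    by split.
  have [a [a0 ea IHs]] := IH (ltnW mk).
  have [ep|ep] := boolP (epoch_start T m.+2).
    exists 0; rewrite mulr0 !addr0; have em := e_start m.+2 mk ep; split=> //.
    rewrite big_nat_recr//= [X in _ <= _ + X]big_nat_recr//= -natr1.
    have := mulr_ge0 (room0 m) a0; have := q0 m.+1; lra.
  have em := e_inner m.+2 mk ep; rewrite /= in em.
  have qT : 0 <= T%:R^-1 * q m.+1 by rewrite mulr_ge0 ?invr_ge0// ltW.
  exists (a + T%:R^-1 * q m.+1); split; [exact: addr_ge0|lra|].
  have roomE : room m = room m.+1 + 1.
    rewrite /room; move: ep; rewrite /epoch_start /= modnS => /negbTE nd.
    rewrite nd natr1 [(T - _.+2)%N]subnS prednK// subn_gt0.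
    have := ltn_pmod m.+1 T0; rewrite modnS nd; exact.
  have roomT : room m * (T%:R^-1 * q m.+1) <= q m.+1.
    rewrite mulrA ler_piMl// ler_pdivrMr// mul1r ler_nat leq_subr//.
  rewrite big_nat_recr//= [X in _ <= _ + X]big_nat_recr//= -natr1.
  by move: roomT IHs; rewrite roomE; lra.
case: k e_start e_inner inv => [|k'] _ _ inv.
  by rewrite !big_geq// mul0r addr0.
have [a [a0 _ h]] := inv k' (ltnSn _).
rewrite [X in _ <= _ + X]big_nat_recr//=.
have := mulr_ge0 (room0 k') a0; have := q0 k'.+1; lra.
Qed.

(** * Expected descent *)

Section Descent.
Context {R : realType} {n : nat} {X : set 'rV[R]_n} {f : 'rV[R]_n -> R}
  {gradf : 'rV[R]_n -> 'rV[R]_n} {L l : R} {xstar : 'rV[R]_n}.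
Context {dXi : measure_display} {Xi : measurableType dXi} {mu : probability Xi R}.
Context {F : 'rV[R]_n -> Xi -> R} {G : 'rV[R]_n -> Xi -> 'rV[R]_n}.
Context {sigma : R} {Lxi : Xi -> R} {Lsup Lms : R}.
Context {k T N : nat} {b b' : nat -> nat} {x0 : 'rV[R]_n} {Lbar0 : R}.
Context {d : measure_display} {Omega : measurableType d} {P : probability Omega R}.
Context {xi xibar : Omega -> nat -> nat -> Xi} {x Gt : Omega -> nat -> 'rV[R]_n}
  {Lhat Lbar gamma : Omega -> nat -> R}.
Hypotheses (X_nonempty : X !=set0) (X_compact : compact X).
Hypothesis X_convex : convex_set (X : set (convex_lmodType 'rV[R]_n)).
Hypothesis f_smooth : smooth_objective X f gradf L l.
Hypothesis xstar_min : is_argmin X f xstar.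
Hypothesis oracle : stochastic_oracle mu X f gradf F G sigma Lxi Lsup Lms.
Hypotheses (k_ge1 : (1 <= k)%N) (T_gt0 : (0 < T)%N) (N_gt0 : (0 < N)%N).
Hypotheses (b_eq : forall t, b t = T) (b'_ge1 : forall t, (1 <= b' t)%N).
Hypotheses (x0_in : X x0) (Lbar0_gt0 : 0 < Lbar0) (Lbar0_le : Lbar0 <= Lsup).
Hypothesis samples_iid :
  iid_family P mu (drawn k T N b b') (sample xi xibar).
Hypothesis run : forall w, AC_VR_SPG_run X F G k T N b b' x0 Lbar0
  (xi w) (xibar w) (x w) (Gt w) (Lhat w) (Lbar w) (gamma w).

Let xX w t (tk : (t <= k)%N) : X (x w t) :=
  iterate_in X_nonempty X_compact x0_in (run w) t tk.
Let M0 w t (tk : (t <= k)%N) : 0 < Lhat w t :=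
  Lhat_gt0 Lbar0_gt0 (run w) t tk.
Let Lsup0 : 0 <= Lsup := ltW (lt_le_trans Lbar0_gt0 Lbar0_le).
Let known t (tk : (t <= k)%N) :=
  known_omega X_nonempty X_compact X_convex oracle x0_in Lbar0_gt0 samples_iid
    run t tk.

Local Notation pastJ J := (past (sample xi xibar) (drawn_seq k T N b b' J)).
Local Notation E h := (Rintegral P [set: Omega] h).
Local Notation step w t := (x w t - x w t.-1).
Local Notation diam := (ediam X).

Lemma ae_sample_le (j : sample_index) : drawn k T N b b' j ->
  {ae P, forall w, Lxi (sample xi xibar j w) <= Lsup}.
Proof.
move=> Dj.
have mbad : measurable [set z | ~ (Lxi z <= Lsup)].
  rewrite (_ : [set z | _] = setT `&` Lxi @^-1` `]Lsup, +oo[).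
    by apply: (oracle_Lxi_measurable oracle) => //; exact: measurable_itv.
  rewrite setTI; apply/seteqP; split => z /=; rewrite in_itv/= andbT.
    by move/negP; rewrite -ltNge.
  by move=> h; apply/negP; rewrite -ltNge.
have mu0 : mu [set z | ~ (Lxi z <= Lsup)] = 0%E.
  by apply/(measure_negligible mbad); exact: (oracle_Lxi_sup oracle).
exists (sample xi xibar j @^-1` [set z | ~ (Lxi z <= Lsup)]); split => //.
  rewrite -[X in measurable X]setTI.
  exact: (iid_measurable samples_iid).
by rewrite (iid_law samples_iid).
Qed.

Lemma ae_samples_le : {ae P, forall w, forall j : sample_index,
  drawn k T N b b' j -> Lxi (sample xi xibar j w) <= Lsup}.
Proof.
suff all_s (s : seq sample_index) : {ae P, forall w, forall j, j \in s ->
    drawn k T N b b' j -> Lxi (sample xi xibar j w) <= Lsup}.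
  apply: filterS (all_s (drawn_seq k T N b b' predT)) => w h j Dj.
  by apply: h => //; rewrite mem_drawn_seq Dj.
elim: s => [|i s IH]; first by apply: nearW.
have [Di|nDi] := boolP (drawn k T N b b' i).
  have := ae_sample_le i Di.
  apply: filterS2 IH => w h hi j; rewrite in_cons => /orP[/eqP ->//|].
  exact: h.
apply: filterS IH => w h j; rewrite in_cons => /orP[/eqP -> Di|].
  by rewrite Di in nDi.
exact: h.
Qed.

Lemma ae_estimates_le : {ae P, forall w,
  (forall t, (t <= k)%N -> Lhat w t <= Lsup) /\
  (forall t, (1 <= t <= k)%N -> Lbar w t <= Lsup)}.
Proof.
apply: filterS ae_samples_le => w hw.
have hxi t i : (1 <= t <= k)%N -> ~~ epoch_start T t -> (i < b t)%N ->
    Lxi (xi w t i) <= Lsup.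
  by move=> tk ep ib; apply: (hw (inl (t, i))); rewrite /= tk (negbTE ep).
have hbar t i : (1 <= t <= k)%N -> (i < b' t)%N -> Lxi (xibar w t i) <= Lsup.
  by move=> tk ib; apply: (hw (inr (t, i))); rewrite /= tk.
split=> t tk.
- apply: (Lhat_le X_nonempty X_compact oracle x0_in Lbar0_gt0 (run w)) => //.
  by move=> s; rewrite b_eq.
- by apply: (Lbar_le X_nonempty X_compact oracle x0_in (run w)) => // i; exact: hbar.
Qed.

Lemma step_le w t : (1 <= t <= k)%N -> enorm (step w t) <= diam.
Proof.
move=> tk; have tle : (t <= k)%N by have /andP[] := tk.
apply: enormB_le_ediam => //; apply: xX => //; exact: pred_leq.
Qed.

Lemma sqr_step_le w t : (1 <= t <= k)%N -> enorm (step w t) ^+ 2 <= diam ^+ 2.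
Proof.
move=> tk; have h := step_le w t tk; have e0 := enorm_ge0 (step w t).
by rewrite ler_pXn2r ?nnegrE// (le_trans e0).
Qed.

Lemma measurable_sqr_step t : (1 <= t <= k)%N ->
  measurable_fun [set: Omega] (fun w => enorm (step w t) ^+ 2).
Proof.
move=> tk; have tle : (t <= k)%N by have /andP[] := tk.
have [mx _ _] := known t tle; have [mxp _ _] := known t.-1 (pred_leq t tk).
exact/measurable_funX/measurable_enorm/mvecB.
Qed.

Lemma L1_bregman t : (1 <= t <= k)%N ->
  @L1 _ _ _ P (fun w => bregman f gradf (x w t) (x w t.-1)).
Proof.
move=> tk; have tle : (t <= k)%N by have /andP[] := tk.
have [mx _ _] := known t tle; have [mxp _ _] := known t.-1 (pred_leq t tk).
have Xt w := xX w t tle; have Xp w := xX w t.-1 (pred_leq t tk).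
have /andP[l0 lL] := objective_curvature_range f_smooth.
have C0 : 0 <= l / 2 + L by lra.
apply: (@L1_le _ _ _ P _ (fun w => (l / 2 + L) * diam ^+ 2)).
- apply: measurable_funB.
    by apply: measurable_funB; apply: (measurable_f X_compact f_smooth).
  by apply: measurable_edot; [exact: (mvec_gradf f_smooth)|exact: mvecB].
- exact: L1_cst.
- move=> w; apply: le_trans (normr_bregman_objective f_smooth _ _ (Xt w) (Xp w)) _.
  by rewrite ler_wpM2l// sqr_step_le.
Qed.

(** The curvature samples are drawn after both endpoints of the step are fixed;
    adding 3/2 Lxi |step|^2 makes the remainder nonnegative so that it can be
    integrated with the past frozen. *)
Lemma expected_bregman_sample t i : (1 <= t <= k)%N -> (i < b' t)%N ->
  let B w := bregman (F ^~ (xibar w t i)) (G ^~ (xibar w t i))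
               (x w t) (x w t.-1) in
  @L1 _ _ _ P B /\ E B = E (fun w => bregman f gradf (x w t) (x w t.-1)).
Proof.
move=> tk ib B; have tle : (t <= k)%N by have /andP[] := tk.
set J := before_xibar t.
have Dj : drawn k T N b b' (inr (t, i)) by rewrite /= tk.
have js : inr (t, i) \notin drawn_seq k T N b b' J.
  by rewrite mem_drawn_seq /= ltnn andbF.
have knownJ s : (s <= t)%N -> @mvec _ _ _ (pastJ J) (x ^~ s).
  move=> st; have sk := leq_trans st tle.
  have hx u : (1 <= u <= s)%N -> @known_xi _ _ T N b _ (pastJ J) xi u.
    move=> /andP[u1 us]; apply: known_xi_past.
      by rewrite u1 (leq_trans us).
    by move=> m; rewrite /= (leq_trans us).
  have hb u : (1 <= u < s)%N -> @known_xibar _ _ b' _ (pastJ J) xibar u.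
    move=> /andP[u1 us]; apply: known_xibar_past.
      by rewrite u1 (leq_trans _ sk)// ltnW.
    by move=> m; rewrite /= (leq_trans us).
  by have [] := run_known X_nonempty X_compact X_convex oracle x0_in Lbar0_gt0
    run (A := pastJ J) s sk hx hb.
have Xt w := xX w t tle; have Xp w := xX w t.-1 (pred_leq t tk).
have mS : measurable_fun [set: pastJ J * Xi] (snd : pastJ J * Xi -> Xi).
  exact: measurable_snd.
pose A := (pastJ J * Xi)%type.
have mx : mvec (fun u : A => x u.1 t).
  exact: (mvec_comp _ _ measurable_fst (knownJ t (leqnn t))).
have mxp : mvec (fun u : A => x u.1 t.-1).
  exact: (mvec_comp _ _ measurable_fst (knownJ t.-1 (leq_pred t))).
have mL : measurable_fun [set: A] (fun u => Lxi u.2).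
  exact: (measurableT_comp (oracle_Lxi_measurable oracle) mS).
pose psi (u : A) := 3 / 2 * Lxi u.2 * enorm (step u.1 t) ^+ 2.
pose bg (u : A) := bregman (F ^~ u.2) (G ^~ u.2) (x u.1 t) (x u.1 t.-1).
have mpsi : measurable_fun [set: A] psi.
  apply: measurable_funM; first exact: measurable_funM.
  exact/measurable_funX/measurable_enorm/mvecB.
have mbg : measurable_fun [set: A] bg.
  apply: measurable_funB.
    apply: measurable_funB.
      exact: (measurable_F_comp X_compact oracle (fun u : A => x u.1 t) snd).
    exact: (measurable_F_comp X_compact oracle (fun u : A => x u.1 t.-1) snd).
  apply: measurable_edot; last exact: mvecB.
  exact: (mvec_G oracle (fun u : A => x u.1 t.-1) snd).
have psi0 u : 0 <= psi u.
  by rewrite mulr_ge0 ?sqr_ge0// mulr_ge0// (oracle_Lxi_ge0 oracle).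
have bg_le u : `|bg u| <= psi u.
  exact: (normr_bregman_sample oracle).
have bp0 u : 0 <= bg u + psi u.
  by have := bg_le u; rewrite ler_norml => /andP[h _]; rewrite -lerBlDr sub0r.
pose m := Rintegral mu [set: Xi] Lxi.
have iL : mu.-integrable [set: Xi] (EFin \o Lxi) by exact: integrable_Lxi oracle Lsup0.
have mE : (\int[mu]_z (Lxi z)%:E = m%:E)%E.
  by rewrite /m /Rintegral fineK//; exact: (integrable_fin_num measurableT iL).
have intM (c : R) (h : Xi -> R) : mu.-integrable [set: Xi] (EFin \o h) ->
    mu.-integrable [set: Xi] (fun z => (c * h z)%:E).
  by move=> ih; exact: (integrableZl measurableT c ih).
have ipsi w : mu.-integrable [set: Xi] (fun z => (psi (w, z))%:E).
  rewrite (_ : (fun _ => _) =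
      (fun z => (3 / 2 * enorm (step w t) ^+ 2 * Lxi z)%:E)); first exact: intM.
  by apply/funext => z; rewrite /psi /= mulrAC.
have psi_mu w : (\int[mu]_z (psi (w, z))%:E
    = (3 / 2 * m * enorm (step w t) ^+ 2)%:E)%E.
  rewrite (_ : (fun _ => _) =
      (fun z => (3 / 2 * enorm (step w t) ^+ 2)%:E * (Lxi z)%:E)%E).
    by rewrite integralZl// mE -EFinM; congr EFin; ring.
  by apply/funext => z; rewrite /psi /= mulrAC EFinM.
have bg_mu w := bregman_unbiased oracle _ _ (Xt w) (Xp w).
have phi_mu w : (\int[mu]_z (bg (w, z) + psi (w, z))%:E
    = (bregman f gradf (x w t) (x w t.-1)
       + 3 / 2 * m * enorm (step w t) ^+ 2)%:E)%E.
  under eq_integral do rewrite EFinD.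
  by rewrite integralD//; [rewrite psi_mu (bg_mu w).2 -EFinD|exact: (bg_mu w).1].
have frozen (h : A -> R) : measurable_fun [set: A] h -> (forall u, 0 <= h u) ->
    (\int[P]_w (h (w, xibar w t i))%:E = \int[P]_w \int[mu]_z (h (w, z))%:E)%E.
  move=> mh h0.
  have := tonelli_past P mu _ _ samples_iid _ (drawn_seq_uniq J)
    (drawn_seq_drawn J) _ (EFin \o h) js Dj.
  by apply; [exact/measurable_EFinP|move=> u; rewrite lee_fin].
have mA (h : A -> R) : measurable_fun [set: A] h ->
    measurable_fun [set: Omega] (fun w => h (w, xibar w t i)).
  move=> mh; apply: (measurableT_comp mh); apply: measurable_fun_pair.
    exact: (measurable_past P mu _ _ samples_iid _ (drawn_seq_drawn J)).
  exact: (iid_measurable samples_iid Dj).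
pose q w := 3 / 2 * m * enorm (step w t) ^+ 2.
have iq : @L1 _ _ _ P q.
  apply/L1Z/(@L1_le _ _ _ P _ (fun=> diam ^+ 2)).
  - exact: measurable_sqr_step.
  - exact: L1_cst.
  - by move=> w; rewrite ger0_norm ?sqr_ge0// sqr_step_le.
have ibf := L1_bregman t tk.
have Epsi : (\int[P]_w (psi (w, xibar w t i))%:E = (E q)%:E)%E.
  by rewrite frozen//; under eq_integral do rewrite psi_mu; exact: L1_EFin.
have Ephi : (\int[P]_w (bg (w, xibar w t i) + psi (w, xibar w t i))%:E
    = (E (fun w => bregman f gradf (x w t) (x w t.-1)) + E q)%:E)%E.
  rewrite (frozen (fun u => bg u + psi u))//; last exact: measurable_funD.
  under eq_integral do rewrite phi_mu.
  by rewrite -RintegralD//; apply: L1_EFin; exact: L1D.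
have ipsiz : @L1 _ _ _ P (fun w => psi (w, xibar w t i)).
  by apply: (L1_ge0 _ (E q)) => //; [exact: mA|rewrite Epsi].
have iphiz : @L1 _ _ _ P
    (fun w => bg (w, xibar w t i) + psi (w, xibar w t i)).
  apply: (L1_ge0 _ (E (fun w => bregman f gradf (x w t) (x w t.-1)) + E q)) => //.
    by apply: (mA (fun u => bg u + psi u)); exact: measurable_funD.
  by rewrite Ephi.
have BE : B = (fun w => (bg (w, xibar w t i) + psi (w, xibar w t i))
                        - psi (w, xibar w t i)).
  by apply/funext => w; rewrite addrK.
rewrite BE; split; first exact: L1B.
rewrite RintegralB//; move: Epsi Ephi; rewrite !L1_EFin// => -[->] [->].
by rewrite addrK.
Qed.

(** The sampled expansion is exact with the curvature Lbar by definition, so in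
    the mean the expansion of f is exact as well. *)
Lemma expected_bregman t : (1 <= t <= k)%N ->
  let B w := Lbar w t * enorm (step w t) ^+ 2 / 2 in
  @L1 _ _ _ P B /\ E B = E (fun w => bregman f gradf (x w t) (x w t.-1)).
Proof.
move=> tk B.
pose Bi i w := bregman (F ^~ (xibar w t i)) (G ^~ (xibar w t i))
               (x w t) (x w t.-1).
have BE : B = (fun w => (b' t)%:R^-1 * \sum_(i < b' t) Bi i w).
  by apply/funext => w; exact: (Lbar_bregman (run w) t tk).
have sums m : (m <= b' t)%N -> @L1 _ _ _ P (fun w => \sum_(i < m) Bi i w) /\
    E (fun w => \sum_(i < m) Bi i w)
    = m%:R * E (fun w => bregman f gradf (x w t) (x w t.-1)).
  elim: m => [_|m IH mb].
    rewrite mul0r; under eq_fun do rewrite big_ord0.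
    by split; [exact: L1_cst|rewrite Rintegral_cst// mul0r].
  have [i1 e1] := IH (ltnW mb).
  have [i2 e2] := expected_bregman_sample t m tk mb.
  rewrite (_ : (fun w => \sum_(i < m.+1) Bi i w)
    = (fun w => \sum_(i < m) Bi i w + Bi m w)); last first.
    by apply/funext => w; rewrite big_ord_recr.
  split; first exact: L1D.
  by rewrite RintegralD// e1 e2 -natr1 mulrDl mul1r.
have [iS eS] := sums (b' t) (leqnn _).
rewrite BE; split; first exact: L1Z.
by rewrite RintegralZl// eS mulrA mulVf ?mul1r// pnatr_eq0 -lt0n.
Qed.

(** The estimates Lhat, continued past the last iteration by the value that a
    new epoch would start from. *)
Definition next_Lhat w t :=
  if (t <= k)%N then Lhat w t else Num.max (Lhat w k) (Lbar w k).

Lemma next_LhatE w t : (t <= k)%N -> next_Lhat w t = Lhat w t.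
Proof. by rewrite /next_Lhat => ->. Qed.

Lemma next_Lhat_step w t : (1 <= t <= k)%N ->
  Lhat w t <= next_Lhat w t.+1 /\ Lbar w t <= next_Lhat w t.+1.
Proof.
move=> /andP[t1 tk]; rewrite /next_Lhat; case: (ltnP t k) => [tk'|kt].
  exact: (Lhat_step (run w) t.+1).
have -> : t = k by apply/eqP; rewrite eqn_leq tk.
by rewrite !le_max !lexx orbT.
Qed.

Lemma next_Lhat_ge w t : Lbar0 <= next_Lhat w t.
Proof.
rewrite /next_Lhat; case: ifP => tk; first exact: (Lhat_ge (run w)).
by rewrite le_max (Lhat_ge (run w)).
Qed.

Lemma ae_next_Lhat_le : {ae P, forall w, forall t, next_Lhat w t <= Lsup}.
Proof.
apply: filterS ae_estimates_le => w [hL hB] t; rewrite /next_Lhat.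
by case: ifP => tk; rewrite ?ge_max hL//= hB ?k_ge1/=.
Qed.

Lemma measurable_next_Lhat t : measurable_fun [set: Omega] (next_Lhat ^~ t).
Proof.
have [tk|kt] := leqP t k.
  by under eq_fun do rewrite next_LhatE//; have [] := known t tk.
rewrite /next_Lhat leqNgt kt /=.
apply: measurable_maxr; first by have [] := known k (leqnn k).
have kk : (1 <= k <= k)%N by rewrite k_ge1 /=.
apply: (measurable_Lbar X_nonempty X_compact oracle x0_in run) => //.
- move=> i ib; have := iid_measurable samples_iid (j := inr (k, i)).
  by apply; rewrite /= kk.
- by have [] := known k (leqnn k).
- by have [] := known k.-1 (leq_pred k).
Qed.

Lemma L1_next_Lhat t : @L1 _ _ _ P (next_Lhat ^~ t).
Proof.
apply: (L1_ae_bounded _ Lsup); first exact: measurable_next_Lhat.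
apply: filterS ae_next_Lhat_le => w h.
by rewrite ger0_norm// (le_trans _ (next_Lhat_ge w t))// ltW.
Qed.

(** What the variance recursion charges to the step of iteration t. *)
Definition scaled_step w t :=
  (next_Lhat w t)^-1 * (next_Lhat w t.+1 ^+ 2 * enorm (step w t) ^+ 2).

Lemma scaled_step_ge0 w t : 0 <= scaled_step w t.
Proof.
apply: mulr_ge0; last by apply: mulr_ge0; exact: sqr_ge0.
by rewrite invr_ge0 (le_trans _ (next_Lhat_ge w t))// ltW.
Qed.

Lemma L1_scaled_step t : (1 <= t <= k)%N -> @L1 _ _ _ P (scaled_step ^~ t).
Proof.
move=> tk; have ML0 w s : 0 < next_Lhat w s := lt_le_trans Lbar0_gt0 (next_Lhat_ge w s).
apply: (L1_ae_bounded _ (Lbar0^-1 * (Lsup ^+ 2 * diam ^+ 2))).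
  apply: measurable_funM.
    apply: measurable_fun_invr; last exact: measurable_next_Lhat.
    by move=> w; rewrite ltW.
  apply: measurable_funM; last exact: measurable_sqr_step.
  exact/measurable_funX/measurable_next_Lhat.
apply: filterS ae_next_Lhat_le => w hL.
rewrite ger0_norm ?scaled_step_ge0//; apply: ler_pM.
- by rewrite invr_ge0 ltW.
- by apply: mulr_ge0; exact: sqr_ge0.
- by rewrite lef_pV2 ?posrE// next_Lhat_ge.
- apply: ler_pM; rewrite ?sqr_ge0 ?sqr_step_le//.
  by rewrite ler_pXn2r ?nnegrE// ltW.
Qed.

Lemma L1_Lhat_step t : (1 <= t <= k)%N ->
  @L1 _ _ _ P (fun w => Lhat w t * enorm (step w t) ^+ 2).
Proof.
move=> tk; have tle : (t <= k)%N by have /andP[] := tk.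
apply: (L1_ae_bounded _ (Lsup * diam ^+ 2)).
  apply: measurable_funM; last exact: measurable_sqr_step.
  by have [] := known t tle.
apply: filterS ae_estimates_le => w [hL _].
rewrite ger0_norm; last by rewrite mulr_ge0 ?sqr_ge0// ltW// M0.
by apply: ler_pM; rewrite ?sqr_ge0 ?sqr_step_le// ?hL// ltW// M0.
Qed.

Local Notation err w t := (grad_error (gradf := gradf) (x := x) (Gt := Gt) w t).

Definition scaled_error w t := (Lhat w t)^-1 * enorm (err w t) ^+ 2.

Lemma scaled_error_ge0 w t : (t <= k)%N -> 0 <= scaled_error w t.
Proof. by move=> tk; rewrite mulr_ge0 ?sqr_ge0// invr_ge0 ltW// M0. Qed.

Lemma measurable_scaled_error t : (1 <= t <= k)%N ->
  measurable_fun [set: Omega] (scaled_error ^~ t).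
Proof.
move=> tk; have [t1 tle] := andP tk.
have [mx mL mG] := known t tle; have [mxp _ _] := known t.-1 (pred_leq t tk).
apply: measurable_funM.
  by apply: measurable_fun_invr => // w; rewrite ltW// M0.
apply/measurable_funX/measurable_enorm/mvecB; first exact: mG.
apply: (mvec_gradf f_smooth) => // w.
by apply: xX; exact: pred_leq.
Qed.

Lemma scaled_error_epoch_start t : (1 <= t <= k)%N -> epoch_start T t ->
  (\int[P]_w (scaled_error w t)%:E <= (Lbar0^-1 * (sigma ^+ 2 / N%:R))%:E)%E.
Proof.
move=> tk ep; have [t1 tle] := andP tk.
have [mx mL mG] := known t tle; have [mxp _ _] := known t.-1 (pred_leq t tk).
have mE : measurable_fun [set: Omega] (fun w => enorm (err w t) ^+ 2).
  apply/measurable_funX/measurable_enorm/mvecB; first exact: mG.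
  apply: (mvec_gradf f_smooth) => // w.
  by apply: xX; exact: pred_leq.
have := variance_epoch_start X_nonempty X_compact X_convex f_smooth oracle x0_in
  Lbar0_gt0 samples_iid run t tk ep N_gt0.
have L0 : (0 <= (Lbar0^-1)%:E :> \bar R)%E by rewrite lee_fin invr_ge0 ltW.
move=> /(lee_wpmul2l L0); rewrite EFinM; apply: le_trans.
rewrite -ge0_integralZl//; first last.
- by move=> w _; rewrite lee_fin sqr_ge0.
- exact/measurable_EFinP.
apply: ge0_le_integral => //.
- by move=> w _; rewrite lee_fin scaled_error_ge0.
- exact/measurable_EFinP/measurable_scaled_error.
- by apply: measurable_funeM; exact/measurable_EFinP.
- move=> w _; rewrite -EFinM lee_fin ler_wpM2r ?sqr_ge0//.
  by rewrite lef_pV2 ?posrE ?M0// (Lhat_ge (run w)).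
Qed.

Lemma scaled_error_epoch_inner t : (1 < t <= k)%N -> ~~ epoch_start T t ->
  (\int[P]_w (scaled_error w t)%:E <= \int[P]_w (scaled_error w t.-1)%:E
    + (T%:R^-1)%:E * \int[P]_w (scaled_step w t.-1)%:E)%E.
Proof.
move=> tk ep; have [t1 tle] := andP tk.
have tk1 : (t.-1 <= k)%N by rewrite (leq_trans (leq_pred _)).
have bt : (0 < b t)%N by rewrite b_eq.
have := variance_epoch_inner X_nonempty X_compact X_convex f_smooth oracle x0_in
  Lbar0_gt0 samples_iid run t tk ep bt.
rewrite b_eq; under [X in (_ <= _ + _ * X)%E -> _]eq_integral => w _.
  rewrite -(next_LhatE w t)// -(next_LhatE w t.-1)//.
  rewrite -[X in next_Lhat w X ^+ 2](prednK (ltnW t1)).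
  over.
by [].
Qed.

Lemma L1_scaled_error t : (1 <= t <= k)%N -> @L1 _ _ _ P (scaled_error ^~ t).
Proof.
elim: t => // t IH tk.
have ge0 w : 0 <= scaled_error w t.+1 by apply: scaled_error_ge0.
have [ep|ep] := boolP (epoch_start T t.+1).
  apply: (L1_ge0 _ _ (measurable_scaled_error _ tk)) => //.
  exact: scaled_error_epoch_start.
have t0 : (0 < t)%N by case: t ep {IH tk ge0} => //; rewrite /epoch_start dvdn0.
have tk' : (1 <= t <= k)%N by rewrite t0 ltnW.
have := scaled_error_epoch_inner t.+1 _ ep; rewrite /= ltnS t0 => /(_ tk).
rewrite (L1_EFin _ (IH tk')) (L1_EFin _ (L1_scaled_step t tk')).
by rewrite -EFinM -EFinD; apply: (L1_ge0 _ _ (measurable_scaled_error _ tk)).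
Qed.

(** This is where the growth of the curvature estimates is paid for: an
    iteration can only lose when the estimate increases, and the loss is
    proportional to the increase, so the losses telescope. *)
Lemma step_balance (M M' B r D : R) : Lbar0 <= M -> M <= M' -> M' <= Lsup ->
  B <= M' -> 0 <= r -> r <= D ->
  B * r / 2 - M * r + 3 / 8 * (M^-1 * (M' ^+ 2 * r))
    <= D * (3 / 4 * (Lsup / Lbar0) + 1 / 2) * (M' - M).
Proof.
move=> LM MM' M'L BM' r0 rD.
have Mp : 0 < M := lt_le_trans Lbar0_gt0 LM.
have sq : M^-1 * M' ^+ 2 = M + (M' - M) * ((M' + M) * M^-1).
  by field; rewrite gt_eqF.
have ratio : (M' + M) * M^-1 <= 2 * (Lsup / Lbar0).
  rewrite mulrA; apply: ler_pM.
  - lra.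
  - by rewrite invr_ge0 ltW.
  - lra.
  - by rewrite lef_pV2 ?posrE.
set c := Lsup / Lbar0 in ratio *.
have c0 : 0 <= c by rewrite divr_ge0// ltW.
have gap : (M' - M) * ((M' + M) * M^-1) <= (M' - M) * (2 * c).
  by rewrite ler_wpM2l// subr_ge0.
apply: (@le_trans _ _ (r * ((3 / 4 * c + 1 / 2) * (M' - M)))); last first.
  rewrite -[leRHS]mulrA; apply: ler_wpM2r => //; apply: mulr_ge0; [lra|by rewrite subr_ge0].
rewrite (_ : _ + _ =
  r * (B / 2 - M + 3 / 8 * (M^-1 * M' ^+ 2))); last by ring.
rewrite ler_wpM2l// sq; lra.
Qed.

Local Notation pg w t := (proj_grad X (x w t.-1) (gradf (x w t.-1)) (gamma w t)).

Lemma sum_shift (h : nat -> R) : \sum_(1 <= t < k.+1) h t = \sum_(i < k) h i.+1.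
Proof. by rewrite big_add1 big_mkord. Qed.

(** Summing the descent inequalities: the values of f telescope, the remainders
    and the scaled errors are exchanged for scaled steps, and the balance of
    each step telescopes in turn. *)
Lemma expected_descent :
  (\int[P]_w (\sum_(i < k) (4 * gamma w i.+1)^-1 * enorm (pg w i.+1) ^+ 2)%:E
   <= (f x0 - f xstar + 7 * Lsup ^+ 2 * diam ^+ 2 / (2 * Lbar0)
        + 3 * k%:R * sigma ^+ 2 / (8 * Lbar0 * N%:R))%:E)%E.
Proof.
have ok (i : 'I_k) : (1 <= i.+1 <= k)%N by rewrite /= ltn_ord.
pose U (i : 'I_k) w := (f (x w i) - f (x w i.+1))
  + (bregman f gradf (x w i.+1) (x w i)
     - Lhat w i.+1 * enorm (step w i.+1) ^+ 2) + 3 / 8 * scaled_error w i.+1.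
have pathwise w (i : 'I_k) :
    (4 * gamma w i.+1)^-1 * enorm (pg w i.+1) ^+ 2 <= U i w.
  have := descent_step (gradf := gradf) X_nonempty X_compact X_convex x0_in
    Lbar0_gt0 (run w) i.+1 (ok i).
  by rewrite /U /bregman /scaled_error /grad_error /=; lra.
have lek (i : 'I_k) : (i <= k)%N := ltnW (ltn_ord i).
have iF s : (s <= k)%N -> @L1 _ _ _ P (fun w => f (x w s)).
  move=> sk; have [mx _ _] := known s sk.
  apply: (@L1_le _ _ _ P _ (fun=> `|f x0| +
    Lip_f (gradf := gradf) (L := L) (l := l) (X := X) x0 * diam)).
  - by apply: (measurable_f X_compact f_smooth) => // w; exact: xX.
  - exact: L1_cst.
  move=> w; rewrite (_ : f (x w s) = f x0 + (f (x w s) - f x0)); last by ring.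
  apply: le_trans (ler_normD _ _) _; rewrite lerD2l.
  have Xs := xX w s sk.
  apply: le_trans (objective_fun_lipschitz X_compact f_smooth x0 _ _ x0_in Xs x0_in) _.
  rewrite ler_wpM2l//; last exact: enormB_le_ediam.
  have /andP[l0 lL] := objective_curvature_range f_smooth.
  have L0 := L_ge0 f_smooth.
  have D0 : 0 <= diam.
    by apply: le_trans (enorm_ge0 (x0 - x0)) _; exact: enormB_le_ediam.
  by rewrite /Lip_f addr_ge0 ?enorm_ge0// mulr_ge0//; lra.
have iBM (i : 'I_k) := L1B _ _ (L1_bregman _ (ok i)) (L1_Lhat_step _ (ok i)).
have ie (i : 'I_k) := L1_scaled_error _ (ok i).
have iU (i : 'I_k) : @L1 _ _ _ P (U i).
  apply: L1D; last by apply: L1Z; exact: ie.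
  by apply: L1D (iBM i); exact: L1B (iF _ (lek i)) (iF _ (ltn_ord i)).
apply: (@le_trans _ _ (\int[P]_w (\sum_(i < k) U i w)%:E)%E).
  apply: ge0_le_integral => //.
  - move=> w _; rewrite lee_fin; apply: sumr_ge0 => i _.
    rewrite mulr_ge0 ?sqr_ge0// invr_ge0 mulr_ge0// ltW//.
    exact: (gamma_gt0 Lbar0_gt0 (run w)).
  - apply/measurable_EFinP/measurable_sum => i.
    have [mx _ _] := known i (lek i).
    have [_ mL _] := known i.+1 (ltn_ord i).
    have mg : measurable_fun [set: Omega] (fun w => gamma w i.+1).
      under eq_fun do rewrite (run_gamma (run _) (ok i)).
      exact: measurable_funM.
    have g0 w : 0 < gamma w i.+1 := gamma_gt0 Lbar0_gt0 (run w) _ (ok i).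
    apply: measurable_funM.
      apply: measurable_fun_invr; last exact: measurable_funM.
      by move=> w; rewrite mulr_ge0// ltW.
    apply/measurable_funX/measurable_enorm; apply: mvec_proj_grad => //.
    by apply: (mvec_gradf f_smooth) => // w; exact: (xX w i (lek i)).
  - by have /integrableP[] := L1_sum _ (index_enum 'I_k) _ iU.
  - by move=> w _; rewrite lee_fin; apply: ler_sum => i _; exact: pathwise.
rewrite L1_EFin; last exact: L1_sum.
rewrite Rintegral_sum// lee_fin.
pose e t := E (scaled_error ^~ t).
pose q t := E (scaled_step ^~ t).
pose c := Lbar0^-1 * (sigma ^+ 2 / N%:R).
pose B i := E (fun w => Lbar w i.+1 * enorm (step w i.+1) ^+ 2 / 2).
pose W i := E (fun w => Lhat w i.+1 * enorm (step w i.+1) ^+ 2).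
pose fE i := E (fun w => f (x w i)).
pose M t := E (next_Lhat ^~ t).
have EU (i : 'I_k) : E (U i) = (fE i - fE i.+1) + (B i - W i) + 3 / 8 * e i.+1.
  have iD : @L1 _ _ _ P (fun w => f (x w i) - f (x w i.+1)).
    exact: L1B (iF _ (lek i)) (iF _ (ltn_ord i)).
  rewrite /U RintegralD//; first last.
  - by apply: L1Z; exact: ie.
  - by apply: L1D => //; exact: iBM.
  rewrite RintegralD//; last exact: iBM.
  rewrite RintegralB//; [|exact: (iF _ (lek i))|exact: (iF _ (ltn_ord i))].
  rewrite RintegralB//; [|exact: (L1_bregman _ (ok i))|exact: (L1_Lhat_step _ (ok i))].
  rewrite RintegralZl//; last exact: ie.
  by rewrite -(expected_bregman _ (ok i)).2.
under eq_bigr do rewrite EU.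
have esum : \sum_(i < k) e i.+1 <= k%:R * c + \sum_(i < k) q i.+1.
  rewrite -!sum_shift; apply: (@epoch_error_sum _ _ T) => //.
  - by move=> t; apply: Rintegral_ge0 => w _; exact: scaled_step_ge0.
  - move=> t tk ep; rewrite -lee_fin -L1_EFin; last exact: L1_scaled_error.
    exact: scaled_error_epoch_start.
  - move=> t tk ep; have [t1 tle] := andP tk.
    have tk0 : (1 <= t <= k)%N by rewrite (ltnW t1).
    have tk1 : (1 <= t.-1 <= k)%N.
      by rewrite (leq_trans (leq_pred _) tle) andbT -ltnS prednK// ltnW.
    have := scaled_error_epoch_inner t tk ep.
    rewrite (L1_EFin _ (L1_scaled_error _ tk0)) (L1_EFin _ (L1_scaled_error _ tk1)).
    by rewrite (L1_EFin _ (L1_scaled_step _ tk1)) -EFinM -EFinD lee_fin.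
pose K := diam ^+ 2 * (3 / 4 * (Lsup / Lbar0) + 1 / 2).
have balance (i : 'I_k) :
    B i - W i + 3 / 8 * q i.+1 <= K * (M i.+2 - M i.+1).
  have [iB _] := expected_bregman _ (ok i).
  have iW := L1_Lhat_step _ (ok i); have iq := L1_scaled_step _ (ok i).
  have iM2 := L1_next_Lhat i.+2; have iM1 := L1_next_Lhat i.+1.
  rewrite /B /W -RintegralB// -RintegralZl// -RintegralD//; first last.
  - exact: L1Z.
  - exact: L1B.
  rewrite /M -RintegralB// -RintegralZl//; last exact: L1B.
  apply: ae_le_Rintegral.
  - by apply: L1D; [exact: L1B|exact: L1Z].
  - by apply: L1Z; exact: L1B.
  apply: filterS ae_next_Lhat_le => w hL.
  have [h1 h2] := next_Lhat_step w _ (ok i).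
  rewrite /scaled_step -(next_LhatE w i.+1 (ltn_ord i)); apply: step_balance => //.
  - exact: next_Lhat_ge.
  - by rewrite next_LhatE.
  - exact: sqr_ge0.
  - exact: sqr_step_le.
have tele (g : nat -> R) m : \sum_(i < m) (g i.+1 - g i) = g m - g 0%N.
  by rewrite -(big_mkord xpredT (fun i => g i.+1 - g i)) telescope_sumr.
have sum_balance : \sum_(i < k) (B i - W i) + 3 / 8 * \sum_(i < k) q i.+1
    <= K * Lsup.
  rewrite mulr_sumr -big_split/=.
  apply: le_trans (ler_sum _ (fun i _ => balance i)) _.
  rewrite -mulr_sumr (tele (fun i => M i.+1)) ler_wpM2l//.
    apply: mulr_ge0; first exact: sqr_ge0.
    by have : 0 <= Lsup / Lbar0 by [rewrite divr_ge0// ltW]; lra.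
  have M1 : 0 <= M 1%N.
    by apply: Rintegral_ge0 => w _; rewrite (le_trans _ (next_Lhat_ge w 1))// ltW.
  have : M k.+1 <= Lsup.
    have -> : Lsup = E (fun=> Lsup).
      rewrite Rintegral_cst// [X in fine X](_ : _ = 1%E) ?mulr1//.
      exact: probability_setT.
    apply: ae_le_Rintegral; [exact: L1_next_Lhat|exact: L1_cst|].
    by apply: filterS ae_next_Lhat_le => w; exact.
  lra.
have fk : f xstar <= fE k.
  have -> : f xstar = E (fun=> f xstar).
    rewrite Rintegral_cst// [X in fine X](_ : _ = 1%E) ?mulr1//.
    exact: probability_setT.
  apply: le_Rintegral => //; [exact: L1_cst|exact: (iF _ (leqnn k))|].
  by move=> w _; apply: (proj2 xstar_min); exact: (xX w k (leqnn k)).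
have f0 : fE 0%N = f x0.
  rewrite /fE; under eq_fun do rewrite (run_x0 (run _)).
  rewrite Rintegral_cst// [X in fine X](_ : _ = 1%E) ?mulr1//.
  exact: probability_setT.
rewrite (_ : \sum_(i < k) _ = (f x0 - fE k) + \sum_(i < k) (B i - W i)
    + 3 / 8 * \sum_(i < k) e i.+1); last first.
  rewrite -f0 -(opprB (fE k)) -(tele fE) -sumrN mulr_sumr -!big_split/=.
  by apply: eq_bigr => i _; rewrite opprB.
have KL : K * Lsup <= 7 * Lsup ^+ 2 * diam ^+ 2 / (2 * Lbar0).
  have -> : 7 * Lsup ^+ 2 * diam ^+ 2 / (2 * Lbar0)
      = diam ^+ 2 * (7 / 2 * (Lsup / Lbar0)) * Lsup.
    by field; rewrite gt_eqF.
  rewrite /K ler_wpM2r// ler_wpM2l ?sqr_ge0//.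
  have : 1 <= Lsup / Lbar0 by rewrite ler_pdivlMr// mul1r.
  lra.
have cE : 3 / 8 * (k%:R * c) = 3 * k%:R * sigma ^+ 2 / (8 * Lbar0 * N%:R).
  by rewrite /c; field; rewrite pnatr_eq0 -lt0n N_gt0 /= gt_eqF.
rewrite -cE; move: esum sum_balance; lra.
Qed.

End Descent.

(** * Sampling the output *)

Section ConditionalWeight.
Import HBNNSimple.
Context {R : realType} {d : measure_display} {Omega : measurableType d}.
Context (P : probability Omega R) (Gen : set (set Omega)).
Hypothesis Gen_measurable : Gen `<=` measurable.

Local Notation T0 := (g_sigma_algebraType Gen).

Lemma measurable_gen (A : set Omega) : @measurable _ T0 A -> measurable A.
Proof.
exact: (smallest_sub (sigma_algebra_measurable Omega) Gen_measurable).
Qed.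

Lemma measurable_fun_gen (h : Omega -> R) :
  measurable_fun [set: T0] (h : T0 -> R) -> measurable_fun [set: Omega] h.
Proof.
by move=> mh _ B mB; apply: measurable_gen; exact: (mh measurableT B mB).
Qed.

Lemma integral_nnsfun_mul (g : {nnsfun T0 >-> R}) (v : Omega -> R) :
  measurable_fun [set: Omega] v -> (forall w, 0 <= v w) ->
  (\int[P]_w (g w * v w)%:E
   = \sum_(r \in range g)
       (r%:E * \int[P]_(w in (g : Omega -> R) @^-1` [set r]) (v w)%:E))%E.
Proof.
move=> mv v0.
have mA r : measurable ((g : Omega -> R) @^-1` [set r]).
  by apply: measurable_gen; exact: (measurable_sfunP g (measurable_set1 r)).
have term0 r w : 0 <= r * \1_((g : Omega -> R) @^-1` [set r]) w.
  rewrite indicE; case: (boolP (w \in _)) => [|_]; last by rewrite mulr0.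
  by rewrite inE /= => <-; rewrite mulr1.
transitivity (\int[P]_w \sum_(r \in range g)
    (r * \1_((g : Omega -> R) @^-1` [set r]) w * v w)%:E)%E.
  apply: eq_integral => w _; rewrite fsumEFin//; congr EFin.
  by rewrite {1}(fimfunE g) -mulr_fsuml.
rewrite ge0_integral_fsum//; last 2 first.
- move=> r; apply/measurable_EFinP/measurable_funM => //.
  by apply: measurable_funM => //; exact: measurable_indic.
- by move=> r w _; rewrite lee_fin mulr_ge0.
apply: eq_fsbigr => r; rewrite inE => -[w0 _ <-].
under eq_integral do rewrite -mulrA EFinM.
rewrite ge0_integralZl//.
- congr (_ * _)%E; rewrite [RHS]integral_mkcond; apply: eq_integral => w _.
  rewrite patchE indicE; case: ifP => _; by rewrite ?mul1r ?mul0r.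
- apply/measurable_EFinP/measurable_funM => //; exact: measurable_indic.
- by move=> w _; rewrite lee_fin mulr_ge0// indicE.
- by rewrite lee_fin.
Qed.

(** The hypothesis on u is the case where h is an indicator; simple functions
    follow by linearity and the general case by monotone convergence. *)
Lemma integral_conditional_weight (D : set Omega) (u h : Omega -> R) :
  measurable D -> measurable_fun [set: Omega] u -> (forall w, 0 <= u w) ->
  (forall A, <<s Gen >> A -> (P (A `&` D) = \int[P]_(w in A) (u w)%:E)%E) ->
  measurable_fun [set: T0] (h : T0 -> R) -> (forall w, 0 <= h w) ->
  (\int[P]_w (h w * \1_D w)%:E = \int[P]_w (h w * u w)%:E)%E.
Proof.
move=> mD mu u0 cond mh h0.
have mD1 : measurable_fun [set: Omega] (\1_D : Omega -> R) by exact: measurable_indic.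
have mhE : measurable_fun [set: T0] (EFin \o (h : T0 -> R)) by exact/measurable_EFinP.
pose g := nnsfun_approx (measurableT : measurable [set: T0]) mhE.
have lim_mul (v : Omega -> R) : measurable_fun [set: Omega] v ->
    (forall w, 0 <= v w) ->
    (\int[P]_w (h w * v w)%:E = limn (fun m => \int[P]_w (g m w * v w)%:E))%E.
  move=> mv v0; rewrite -monotone_convergence//.
  - apply: eq_integral => w _; apply/esym/cvg_lim => //.
    rewrite (_ : (fun m => (g m w * v w)%:E) = (fun m => (g m w)%:E * (v w)%:E)%E).
      rewrite EFinM; apply: cvgeZr => //.
      by apply: (cvg_nnsfun_approx _ mhE) => // t _; rewrite lee_fin.
    by apply/funext => m; rewrite EFinM.
  - move=> m; apply/measurable_EFinP/measurable_funM => //.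
    exact: measurable_fun_gen.
  - by move=> m w _; rewrite lee_fin mulr_ge0.
  - move=> w _ m1 m2 m12; rewrite lee_fin ler_wpM2r//.
    have := nd_nnsfun_approx (measurableT : measurable [set: T0]) mhE m12.
    by move=> /lefP; exact.
rewrite lim_mul//.
rewrite lim_mul//; congr (limn _); apply/funext => m.
rewrite !integral_nnsfun_mul//.
apply: eq_fsbigr => r _; congr (_ * _)%E.
have mA : @measurable _ T0 ((g m : Omega -> R) @^-1` [set r]).
  exact: (measurable_sfunP (g m) (measurable_set1 r)).
rewrite -cond// integral_indic//; last exact: measurable_gen.
by rewrite setIC.
Qed.

End ConditionalWeight.

(** * The bounds for the sampled projected gradient *)

Theorem theorem7 (R : realType) (n : nat)
    (X : set 'rV[R]_n) (f : 'rV[R]_n -> R) (gradf : 'rV[R]_n -> 'rV[R]_n)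
    (L l : R) (xstar : 'rV[R]_n)
    (dXi : measure_display) (Xi : measurableType dXi) (mu : probability Xi R)
    (F : 'rV[R]_n -> Xi -> R) (G : 'rV[R]_n -> Xi -> 'rV[R]_n)
    (sigma : R) (Lxi : Xi -> R) (Lsup Lms : R)
    (k T N : nat) (b b' : nat -> nat) (x0 : 'rV[R]_n) (Lbar0 : R)
    (dOmega : measure_display) (Omega : measurableType dOmega)
    (P : probability Omega R)
    (xi xibar : Omega -> nat -> nat -> Xi)
    (x Gt : Omega -> nat -> 'rV[R]_n) (Lhat Lbar gamma : Omega -> nat -> R)
    (Rk : Omega -> 'I_k)
    (X_nonempty : X !=set0)
    (X_convex : convex_set (X : set (convex_lmodType 'rV[R]_n)))
    (X_compact : compact X)
    (f_smooth : smooth_objective X f gradf L l)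
    (xstar_min : is_argmin X f xstar)
    (oracle : stochastic_oracle mu X f gradf F G sigma Lxi Lsup Lms)
    (k_ge1 : (1 <= k)%N) (T_gt0 : (0 < T)%N) (N_gt0 : (0 < N)%N)
    (b_eq : forall t, b t = T) (b'_ge1 : forall t, (1 <= b' t)%N)
    (x0_in : X x0) (Lbar0_range : 0 < Lbar0 <= Lsup)
    (samples_iid : iid_family P mu (drawn k T N b b') (sample xi xibar))
    (run : forall w, AC_VR_SPG_run X F G k T N b b' x0 Lbar0 (xi w) (xibar w)
      (x w) (Gt w) (Lhat w) (Lbar w) (gamma w))
    (output : output_rule P x gamma Rk) :
  let gX w := proj_grad X (x w (Rk w)) (gradf (x w (Rk w)))
                (gamma w (Rk w).+1) in
  ('E_P[fun w =>
        ((\sum_(1 <= t < k.+1) (4 * gamma w t)^-1) * enorm (gX w) ^+ 2)%R]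
     <= (f x0 - f xstar
         + 7 * Lsup ^+ 2 * ediam X ^+ 2 / (2 * Lbar0)
         + 3 * k%:R * sigma ^+ 2 / (8 * Lbar0 * N%:R))%:E)%E
  /\
  ('E_P[fun w => (enorm (gX w) ^+ 2)%R]
     <= (16 * Lsup * (f x0 - f xstar) / k%:R
         + 56 * Lsup ^+ 3 * ediam X ^+ 2 / (Lbar0 * k%:R)
         + 6 * Lsup * sigma ^+ 2 / (Lbar0 * N%:R))%:E)%E.
Proof.
move=> gX.
have /andP[Lbar0_gt0 Lbar0_le] := Lbar0_range.
have xX w t (tk : (t <= k)%N) : X (x w t) :=
  iterate_in X_nonempty X_compact x0_in (run w) t tk.
have ok (r : 'I_k) : (1 <= r.+1 <= k)%N by rewrite /= ltn_ord.
have g0 w (r : 'I_k) : 0 < gamma w r.+1 := gamma_gt0 Lbar0_gt0 (run w) _ (ok r).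
pose S w := \sum_(1 <= t < k.+1) (4 * gamma w t)^-1.
pose S' w := \sum_(1 <= t < k.+1) (gamma w t)^-1.
have S'E w : S' w = \sum_(r < k) (gamma w r.+1)^-1 by exact: sum_shift.
have SE w : S w = 4^-1 * S' w.
  by rewrite /S mulr_sumr; apply: eq_bigr => t _; rewrite invfM.
have S'0 w : 0 < S' w.
  rewrite S'E (bigD1 (Ordinal k_ge1))//= ltr_pwDl ?invr_gt0//.
    exact: (g0 w (Ordinal k_ge1)).
  by apply: sumr_ge0 => r _; rewrite invr_ge0 ltW.
have S0 w : 0 < S w by rewrite SE mulr_gt0.
pose pg w (r : 'I_k) := proj_grad X (x w r) (gradf (x w r)) (gamma w r.+1).
pose h (r : 'I_k) w := S w * enorm (pg w r) ^+ 2.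
pose u (r : 'I_k) w := (S' w)^-1 * (gamma w r.+1)^-1.
pose D (r : 'I_k) := [set w | Rk w = r].
have h0 r w : 0 <= h r w by rewrite mulr_ge0 ?sqr_ge0// ltW.
have u0 r w : 0 <= u r w by rewrite mulr_ge0// invr_ge0 ltW.
(* The sampling weights are such that they cancel the common factor S. *)
have uh r w : h r w * u r w = (4 * gamma w r.+1)^-1 * enorm (pg w r) ^+ 2.
  by rewrite /h /u SE; field; rewrite !gt_eqF.
(* The generators of the trajectory events. *)
pose Gen : set (set Omega) := [set A | exists t : nat, (1 <= t <= k)%N /\
  exists U : set R, measurable U /\
    (A = (fun w => gamma w t) @^-1` U \/
     exists i : 'I_n, A = (fun w => x w t.-1 0 i) @^-1` U)].
have kn t (tk : (t <= k)%N) := known_omega X_nonempty X_compact X_convex oracle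
  x0_in Lbar0_gt0 samples_iid run t tk.
have mgamma t : (1 <= t <= k)%N -> measurable_fun [set: Omega] (gamma ^~ t).
  move=> tk; have [_ tle] := andP tk; have [_ mL _] := kn t tle.
  under eq_fun do rewrite (run_gamma (run _) tk).
  exact: measurable_funM.
have Gen_measurable : Gen `<=` measurable.
  move=> _ [t [tk [U [mU [->|[i ->]]]]]].
    by have := mgamma t tk measurableT U mU; rewrite setTI.
  have [mx _ _] := kn t.-1 (pred_leq t tk).
  by have := mx i measurableT U mU; rewrite setTI.
pose T0 := g_sigma_algebraType Gen.
have gen_gamma t : (1 <= t <= k)%N ->
    measurable_fun [set: T0] (fun w : T0 => gamma w t).
  move=> tk _ U mU; rewrite setTI; apply: sub_sigma_algebra.
  by exists t; split => //; exists U; split => //; left.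
have gen_x (r : 'I_k) : mvec (fun w : T0 => x w r).
  move=> i _ U mU; rewrite setTI; apply: sub_sigma_algebra.
  exists r.+1; split; first exact: ok.
  by exists U; split => //; right; exists i.
have mpg r : mvec (fun w : T0 => pg w r).
  apply: mvec_proj_grad => //; last exact: gen_gamma.
  by apply: (mvec_gradf f_smooth) => // w; apply: xX; exact: ltnW.
have mS' : measurable_fun [set: T0] (S' : T0 -> R).
  rewrite (_ : S' = fun w => \sum_(r < k) (gamma w r.+1)^-1); last exact/funext.
  apply: measurable_sum => r.
  by apply: measurable_fun_invr; [move=> w; exact: ltW|exact: gen_gamma].
have mS : measurable_fun [set: T0] (S : T0 -> R).
  rewrite (_ : S = fun w => 4^-1 * S' w); last exact/funext.
  exact: measurable_funM.
have mh r : measurable_fun [set: T0] (h r : T0 -> R).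
  by apply: measurable_funM => //; exact/measurable_funX/measurable_enorm.
have mu_ r : measurable_fun [set: T0] (u r : T0 -> R).
  apply: measurable_funM.
    by apply: measurable_fun_invr => // w; exact: ltW.
  by apply: measurable_fun_invr; [move=> w; exact: ltW|exact: gen_gamma].
have toO (v : Omega -> R) : measurable_fun [set: T0] (v : T0 -> R) ->
    measurable_fun [set: Omega] v.
  exact: measurable_fun_gen Gen_measurable v.
have mD r : measurable (D r) by have [] := output r.
(* Random selection as a sum over the possible outcomes. *)
have select (v : 'I_k -> R) w : v (Rk w) = \sum_(r < k) v r * \1_(D r) w.
  rewrite (bigD1 (Rk w))//= big1 ?addr0 => [|r rR].
    by rewrite indicE mem_set ?mulr1.
  rewrite indicE memNset ?mulr0// => Dr.
  by rewrite -[r]Dr eqxx in rR.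
have m1D r : measurable_fun [set: Omega] (\1_(D r) : Omega -> R).
  exact: measurable_indic.
have first_bound :
  (\int[P]_w (S w * enorm (gX w) ^+ 2)%:E
     <= (f x0 - f xstar
         + 7 * Lsup ^+ 2 * ediam X ^+ 2 / (2 * Lbar0)
         + 3 * k%:R * sigma ^+ 2 / (8 * Lbar0 * N%:R))%:E)%E.
  apply: le_trans (expected_descent X_nonempty X_compact X_convex f_smooth
    xstar_min oracle k_ge1 T_gt0 N_gt0 b_eq b'_ge1 x0_in Lbar0_gt0 Lbar0_le
    samples_iid run).
  have hE w : S w * enorm (gX w) ^+ 2 = \sum_(r < k) h r w * \1_(D r) w.
    exact: (select (h ^~ w)).
  under eq_integral do rewrite hE -sumEFin.
  rewrite ge0_integral_sum//; last 2 first.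
  - by move=> r; apply/measurable_EFinP/measurable_funM => //; exact: toO.
  - by move=> r w _; rewrite lee_fin mulr_ge0// indicE.
  rewrite [leRHS](_ : _ = \int[P]_w \sum_(r < k) (h r w * u r w)%:E)%E.
    rewrite ge0_integral_sum//; last 2 first.
    - by move=> r; apply/measurable_EFinP/measurable_funM; exact: toO.
    - by move=> r w _; rewrite lee_fin mulr_ge0.
    apply: lee_sum => r _; rewrite (integral_conditional_weight P Gen
      Gen_measurable (D r) (u r) (h r))//; first exact: toO.
    by have [] := output r.
  by apply: eq_integral => w _; rewrite sumEFin; under [in RHS]eq_bigr do rewrite uh.
have Lsup0 : 0 < Lsup := lt_le_trans Lbar0_gt0 Lbar0_le.
have k0 : 0 < k%:R :> R by rewrite ltr0n.
split; first by rewrite unlock.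
(* Almost surely 1 <= c S, since each of the k terms of S is at least
   1 / (16 Lsup). *)
pose c := 16 * Lsup / k%:R.
have c0 : 0 <= c by rewrite divr_ge0// mulr_ge0// ltW.
have mg2 : measurable_fun [set: Omega] (fun w => enorm (gX w) ^+ 2).
  have gE w : enorm (gX w) ^+ 2
      = \sum_(r < k) enorm (pg w r) ^+ 2 * \1_(D r) w.
    exact: (select (fun r => enorm (pg w r) ^+ 2)).
  under eq_fun do rewrite gE.
  apply: measurable_sum => r; apply: measurable_funM => //.
  exact/toO/measurable_funX/measurable_enorm.
have mSg : measurable_fun [set: Omega] (fun w => S w * enorm (gX w) ^+ 2).
  by apply: measurable_funM => //; exact: toO.
have Sg0 w : 0 <= S w * enorm (gX w) ^+ 2 by rewrite mulr_ge0 ?sqr_ge0// ltW.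
rewrite unlock; apply: (@le_trans _ _
    (c%:E * \int[P]_w (S w * enorm (gX w) ^+ 2)%:E)%E).
  rewrite -ge0_integralZl//; last 2 first.
  - exact/measurable_EFinP.
  - by move=> w _; rewrite lee_fin.
  apply: ae_ge0_le_integral => //.
  - by move=> w _; rewrite lee_fin sqr_ge0.
  - exact/measurable_EFinP.
  - by move=> w _; rewrite -EFinM lee_fin mulr_ge0.
  - by apply: measurable_funeM; exact/measurable_EFinP.
  have := ae_estimates_le X_nonempty X_compact oracle T_gt0 b_eq b'_ge1 x0_in Lbar0_gt0
    Lbar0_le samples_iid run.
  apply: filterS => w [hL _] _; rewrite -EFinM lee_fin mulrA ler_peMl ?sqr_ge0//.
  rewrite /c SE S'E.
  have : \sum_(r < k) (4 * Lsup)^-1 <= \sum_(r < k) (gamma w r.+1)^-1.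
    apply: ler_sum => r _; rewrite lef_pV2 ?posrE ?g0 ?mulr_gt0//.
    by rewrite (run_gamma (run w) (ok r)) ler_pM2l// hL.
  rewrite sumr_const card_ord -[_ *+ k]mulr_natl => le_sum.
  have := ler_wpM2l c0 le_sum; rewrite /c.
  have -> : 16 * Lsup / k%:R * (k%:R * (4 * Lsup)^-1) = 4.
    by field; rewrite !gt_eqF.
  by move=> h4; rewrite mulrCA -ler_pdivrMl// invrK mulr1.
apply: le_trans (lee_wpmul2l _ first_bound) _; first by rewrite lee_fin.
rewrite -EFinM lee_fin le_eqVlt; apply/orP; left; apply/eqP.
rewrite /c; field.
by rewrite pnatr_eq0 -lt0n N_gt0 !gt_eqF.
Qed.
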